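(* Let $h\in G_d$ with $d>1$, let $g(x)=h^{-1}(1/x)$ and $f(x)=1/h(1/x)$, and let $\Omega\subset\mathbb R^2$ be defined by $$\Omega=\{(x,y)\in\mathbb R^2:\ x\ge1,\ |y|\le g(x)\}.$$ Then the eigenvalue counting function $N(\lambda,\Omega)$ of the Dirichlet problem $-\Delta u=\lambda u$ in $\Omega$, $u=0$ on $\partial\Omega$, satisfies, as $\lambda\to\infty$, $$N(\lambda,\Omega)\le\frac{d}{d-1}\,\lambda^{1/2}f\Big(\frac{2\lambda^{1/2}}{\pi}\Big)+o\Big(\lambda^{1/2}f\Big(\frac{2\lambda^{1/2}}{\pi}\Big)\Big).$$
   Context: For $d>1$, $G_d$ is the class of continuous functions $h:(0,\infty)\to(0,\infty)$ such that: (i) $h$ is strictly increasing, $\lim_{x\to0^+}h(x)=0$ and $\lim_{x\to\infty}h(x)=\infty$; (ii) for every $t>0$, $\lim_{x\to0^+}h(tx)/h(x)=t^d$, uniformly for $t$ in compact subsets of $(0,\infty)$; (iii) $\lim_{x\to0^+}h(x)/x=0$. The eigenvalue problem is understood for the Dirichlet Laplacian (form domain $H_0^1$ of the interior of $\Omega$). Since $g(x)\searrow0$ as $x\to\infty$, the domain is quasibounded and the spectrum is discrete: a sequence $0<\lambda_1<\lambda_2\le\cdots\nearrow\infty$, eigenvalues being repeated according to multiplicity. $N(\lambda,\Omega)=\#\{n\in\mathbb N:\lambda_n\le\lambda\}$. *)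

(* Defs.v *)
From HB Require Import structures.
From mathcomp Require Import all_boot all_order all_algebra finmap.
From mathcomp Require Import all_classical all_reals all_analysis.

Set Implicit Arguments.
Unset Strict Implicit.
Unset Printing Implicit Defensive.

Import Order.TTheory GRing.Theory Num.Theory.
Import numFieldNormedType.Exports.

Local Open Scope classical_set_scope.
Local Open Scope ring_scope.

Definition plane_measure (R : realType) :=
  (@lebesgue_measure R \x @lebesgue_measure R)%E.

HB.instance Definition _ (R : realType) := Measure.on (@plane_measure R).

(* G_d; (ii) is convergence of the functions t |-> h (t * x) / h x in the
   topology of uniform convergence on K, for each compact K (singletons give
   the pointwise limit). *)
Record regular_class (R : realType) (d : R) (h : R -> R) : Prop := RegularClass {
  regular_gt0 : forall x, 0 < x -> 0 < h x;
  regular_continuous : {within `]0, +oo[, continuous h};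
  regular_increasing : {in `]0, +oo[ &, {homo h : x y / x < y}};
  regular_cvg0 : h x @[x --> 0^'+] --> 0;
  regular_cvgy : h x @[x --> +oo] --> +oo;
  regular_variation : forall K : set R, compact K -> K `<=` `]0, +oo[ ->
    {uniform K, (fun x t => h (t * x) / h x) @ 0^'+ --> (fun t => t `^ d)};
  regular_div_cvg0 : h x / x @[x --> 0^'+] --> 0
}.

(* The inverse of h : ]0, +oo[ -> ]0, +oo[. *)
Definition half_line_inverse (R : realType) (h : R -> R) : R -> R :=
  'pinv_(fun=> 0) `]0, +oo[ h.

Definition horn (R : realType) (g : R -> R) : set (R * R) :=
  [set p | 1 <= p.1 /\ `|p.2| <= g p.1].

(* C^infinity: every iterated directional derivative is Frechet differentiable
   everywhere, hence also continuous. *)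
Definition smooth (R : realType) (phi : R * R -> R) : Prop :=
  forall (s : seq (R * R)) (p : R * R),
    differentiable (foldr (fun v psi => 'D_v psi) phi s) p.

Definition test_function (R : realType) (U : set (R * R)) (phi : R * R -> R)
    : Prop :=
  [/\ smooth phi,
      compact (closure [set p | phi p != 0]) &
      closure [set p | phi p != 0] `<=` U].

Definition partial1 (R : realType) (phi : R * R -> R) : R * R -> R :=
  'D_((1, 0) : R * R) phi.
Definition partial2 (R : realType) (phi : R * R -> R) : R * R -> R :=
  'D_((0, 1) : R * R) phi.

Definition L2 (R : realType) (U : set (R * R)) (u : R * R -> R) : Prop :=
  measurable_fun U u /\
  (@plane_measure R).-integrable U (fun p => (u p ^+ 2)%:E).

Definition L2_inner (R : realType) (U : set (R * R)) (u v : R * R -> R) : R :=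
  \int[@plane_measure R]_(p in U) (u p * v p).

Definition L2_cvg (R : realType) (U : set (R * R)) (u_ : nat -> R * R -> R)
    (u : R * R -> R) : Prop :=
  (\int[@plane_measure R]_(p in U) ((u_ n p - u p) ^+ 2)%:E)%E
    @[n --> \oo] --> 0%E.

(* [H1 U u u1 u2]: u is in H^1(U) and (u1, u2) is its weak gradient. *)
Definition H1 (R : realType) (U : set (R * R)) (u u1 u2 : R * R -> R) : Prop :=
  [/\ L2 U u, L2 U u1, L2 U u2 &
      forall phi, test_function U phi ->
        L2_inner U u (partial1 phi) = - L2_inner U u1 phi /\
        L2_inner U u (partial2 phi) = - L2_inner U u2 phi].

(* [H10 U u u1 u2]: moreover u is in H^1_0(U), the closure of the test
   functions for the H^1 norm. *)
Definition H10 (R : realType) (U : set (R * R)) (u u1 u2 : R * R -> R) : Prop :=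
  H1 U u u1 u2 /\
  exists phi_ : nat -> R * R -> R,
    [/\ forall n, test_function U (phi_ n),
        L2_cvg U phi_ u,
        L2_cvg U (fun n => partial1 (phi_ n)) u1 &
        L2_cvg U (fun n => partial2 (phi_ n)) u2].

(* The eigenspace of the operator associated with the closed form
   (u, w) |-> \int_U grad u . grad w of domain H^1_0(U). *)
Definition dirichlet_eigenspace (R : realType) (U : set (R * R)) (mu : R)
    (u : R * R -> R) : Prop :=
  exists u1 u2, H10 U u u1 u2 /\
    forall w w1 w2, H10 U w w1 w2 ->
      L2_inner U u1 w1 + L2_inner U u2 w2 = mu * L2_inner U u w.

(* Linear independence in L^2(U), i.e. up to equality almost everywhere. *)
Definition L2_independent (R : realType) (U : set (R * R)) (n : nat)
    (u : 'I_n -> R * R -> R) : Prop :=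
  forall c : 'I_n -> R,
    {ae @plane_measure R, forall p, U p -> \sum_(i < n) c i * u i p = 0} ->
    forall i, c i = 0.

(* Dimension of the eigenspace: 0 when mu is not an eigenvalue, +oo when the
   eigenspace is infinite-dimensional. *)
Definition dirichlet_multiplicity (R : realType) (U : set (R * R)) (mu : R)
    : \bar R :=
  ereal_sup [set n%:R%:E | n in [set n : nat |
    exists u : 'I_n -> R * R -> R,
      (forall i, dirichlet_eigenspace U mu (u i)) /\ L2_independent U u]].

(* Number of Dirichlet eigenvalues <= lambda of the interior of Omega, counted
   with multiplicity; see [counting_functionE]. *)
Definition counting_function (R : realType) (lambda : R) (Omega : set (R * R))
    : \bar R :=
  (\esum_(mu in [set mu | (mu <= lambda)%R])
     dirichlet_multiplicity Omega° mu)%E.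

Lemma iter_adde1 (R : realType) (n : nat) :
  (iter n (adde 1) 0 = n%:R%:E :> \bar R)%E.
Proof. by elim: n => [|n IH] //=; rewrite IH -natr1 addrC. Qed.

Lemma esum1_counting (R : realType) (T : choiceType) (A : set T) :
  (\esum_(i in A) 1 = counting A :> \bar R)%E.
Proof.
rewrite /counting; case: asboolP => [fA|iA].
  by rewrite esum_fset// fsbig_finite//= big_const_seq count_predT iter_adde1.
apply/eqyP => r r0.
have [B BA cB] := infinite_set_fset (Num.truncn r).+1 iA.
apply: esum_ge; exists [set` B]; first by split.
rewrite fsbig_finite//= set_fsetK big_const_seq count_predT iter_adde1.
by rewrite lee_fin (le_trans (ltW (truncnS_gt r)))// ler_nat.
Qed.

(* If (lam n) lists the eigenvalues repeated according to multiplicity, then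
   N(lambda) = #{n : lam n <= lambda}. *)
Lemma counting_functionE (R : realType) (Omega : set (R * R)) (lam : nat -> R)
    (lambda : R) :
  (forall mu, dirichlet_multiplicity Omega° mu = counting [set n | lam n = mu]) ->
  counting_function lambda Omega = counting [set n | lam n <= lambda].
Proof.
move=> lamE; rewrite /counting_function -esum1_counting.
under eq_esum do rewrite lamE -esum1_counting.
rewrite esum_esum//.
rewrite (reindex_esum [set n | lam n <= lambda] _ (fun n => (lam n, n)))//.
split => [n /= nl //|x y _ _ []//|].
by move=> [m n] /= [mlambda nm]; exists n; rewrite /= nm.
Qed.

(* Main.v *)
(* The horn is cut along the grid of squares of side l = pi / (t sqrt lambda),
   with t > 1 close to 1. On a square the mean-zero condition gives the Neumann
   bound |grad u|^2 >= b^2 |u|^2 for every b < pi / l = t sqrt lambda; no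
   condition is needed when u vanishes on the horizontal midline of the square,
   and in particular when that midline lies outside the horn. Hence a function
   of H^1_0 whose means vanish on the remaining squares satisfies
   b^2 |u|^2 <= |grad u|^2 with b^2 > lambda, so that the eigenfunctions of
   eigenvalue at most lambda span a space of dimension at most the number of
   these squares. Their number is at most
   (2 / l) sum_n 1 / h ((2n + 1) l / 2), which the doubling estimate
   h (2x) >= (1 + d) h x bounds by (2 / l) d / (d - 1) / h (l / 2) up to a term
   that (iii) makes negligible. The ratio to d / (d - 1) * F lambda tends
   to 2 t^(d + 1) / pi < 1, so that r := 0 will do. *)
From HB Require Import structures.
Require Import Defs.
From mathcomp Require Import all_boot all_order all_algebra finmap.
From mathcomp Require Import all_classical all_reals all_analysis.
From mathcomp Require Import measurable_realfun.
From mathcomp Require Import ring lra.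

Set Implicit Arguments.
Unset Strict Implicit.
Unset Printing Implicit Defensive.

Import Order.TTheory GRing.Theory Num.Theory.
Import numFieldNormedType.Exports.

Local Open Scope classical_set_scope.
Local Open Scope ring_scope.

(** * One-dimensional inequalities *)

(** Neumann bracketing over all squares that meet the horn would give no bound: the two rows along
    the axis meet it in infinitely many squares. The grid is therefore placed with the axis as a
    grid line, so that every midline stands at a positive height and leaves the horn at a finite
    abscissa. From there on, vanishing on the midline replaces the mean-zero condition at no loss:
    an interval of length [l / 2] with one fixed and one free end has lowest frequency [pi / l],
    which is also the Neumann gap of an interval of length [l].

    The threshold [b] stays strictly below [pi / l] because the weights that prove the
    one-dimensional bound are tangents, which blow up after a quarter period. To have
    [b ^ 2 > lambda] all the same, the squares are shrunk by [t], at the price of a factor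
    [t ^ (d + 1)] in the count. This is affordable: for [t = 1] the count would stay below the claim
    by the factor [2 / pi], and this gap also pays for the rows to which the doubling estimate does
    not apply. *)

Section one_dimensional.
Context {R : realType}.
Notation mu := (@lebesgue_measure R).
Implicit Types (w dw : R -> R) (a b c l m x y : R).

Lemma cvg_sqr (T : Type) (F : set_system T) (FF : Filter F) (f : T -> R) l :
  f @ F --> l -> (fun t => f t ^+ 2) @ F --> l ^+ 2.
Proof. by move=> fl; apply: (cvgM fl fl). Qed.

Lemma is_derive_continuous w dw :
  (forall y, is_derive y 1 w (dw y)) -> continuous w.
Proof.
move=> wdw y; apply: differentiable_continuous; apply/derivable1_diffP.
by have [] := wdw y.
Qed.

Lemma continuous_itv_integrable w a b :
  continuous w -> mu.-integrable `[a, b] (EFin \o w).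
Proof.
move=> cw; apply: continuous_compact_integrable; first exact: segment_compact.
exact: continuous_subspaceT.
Qed.

(* Jacobi's method: [q := b tan (b (c - y))] solves [q' = - b^2 - q^2], hence
   [dw^2 - b^2 w^2 = (q w^2)' + (q w - dw)^2]. *)
Lemma tan_weight_le w dw b c a1 a2 :
  (forall y, is_derive y 1 w (dw y)) -> continuous dw -> a1 < a2 ->
  (forall y, a1 <= y <= a2 -> - (pi / 2) < b * (c - y) < pi / 2) ->
  b * tan (b * (c - a2)) * w a2 ^+ 2 - b * tan (b * (c - a1)) * w a1 ^+ 2 <=
  \int[mu]_(y in `[a1, a2]) (dw y ^+ 2 - b ^+ 2 * w y ^+ 2).
Proof.
move=> wdw cdw a12 bc.
have cw := is_derive_continuous wdw.
pose q y := b * tan (b * (c - y)).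
have dq y : a1 <= y <= a2 -> is_derive y 1 q (- b ^+ 2 - q y ^+ 2).
  move=> /bc/cos_gt0_pihalf cos_gt0.
  have dt := is_derive_tan (lt0r_neq0 cos_gt0).
  have di : is_derive y (1:R) (fun y => b * (c - y)) (- b).
    have d1 := is_deriveB (is_derive_cst c y (1:R)) (is_derive_id y (1:R)).
    apply: (is_derive_eq (is_deriveZ b d1)).
    by rewrite /GRing.scale/= sub0r mulrN1.
  have dc := @is_derive1_comp R tan (fun y => b * (c - y)) y _ _ dt di.
  apply: (is_derive_eq (is_deriveZ b dc)).
  rewrite cos2_tan2 ?lt0r_neq0// /q /GRing.scale/=; ring.
pose G y := q y * w y ^+ 2.
have dG y : a1 <= y <= a2 -> is_derive y 1 G
   (dw y ^+ 2 - b ^+ 2 * w y ^+ 2 - (q y * w y - dw y) ^+ 2).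
  move=> /dq dqy; have dwy := wdw y.
  have dw2 : is_derive y 1 (fun y => w y ^+ 2) (2 * w y * dw y).
    apply: (is_derive_eq (is_deriveM dwy dwy)).
    by rewrite /GRing.scale/=; ring.
  apply: (is_derive_eq (is_deriveM dqy dw2)); rewrite /GRing.scale/=; ring.
have cq y : a1 <= y <= a2 -> {for y, continuous q}.
  move=> /dq ?; apply: differentiable_continuous; apply/derivable1_diffP.
  by [].
have cG y : a1 <= y <= a2 -> {for y, continuous G}.
  move=> /dG ?; apply: differentiable_continuous; apply/derivable1_diffP.
  by [].
pose g y := dw y ^+ 2 - b ^+ 2 * w y ^+ 2 - (q y * w y - dw y) ^+ 2.
pose f y := dw y ^+ 2 - b ^+ 2 * w y ^+ 2.
have cf : continuous f.
  move=> y; apply: cvgB; first by apply: cvg_sqr; exact: cdw.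
  by apply: cvgM; [exact: cvg_cst|apply: cvg_sqr; exact: cw].
have cg : {within `[a1, a2], continuous g}.
  apply: continuous_in_subspaceT => y; rewrite inE/= in_itv/= => yI.
  apply: cvgB; first exact: cf.
  apply: cvg_sqr; apply: cvgB; last exact: cdw.
  by apply: cvgM; [exact: cq|exact: cw].
have FTC : \int[mu]_(y in `[a1, a2]) g y = G a2 - G a1.
  rewrite /Rintegral (continuous_FTC2 a12 cg (F := G))//.
    split => [y||].
    - by rewrite in_itv/= => /andP[/ltW a1y /ltW ya2]; have [] := dG y; rewrite ?a1y.
    - by apply: cvg_at_right_filter; apply: cG; rewrite lexx ltW.
    - by apply: cvg_at_left_filter; apply: cG; rewrite lexx ltW.
  move=> y; rewrite in_itv/= => /andP[/ltW a1y /ltW ya2].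
  by rewrite derive1E; apply: derive_val; apply: dG; rewrite a1y.
rewrite -/(q a2) -/(q a1) -/(G a2) -/(G a1) -FTC; apply: le_Rintegral => //.
- by apply: continuous_compact_integrable => //; exact: segment_compact.
- exact: continuous_itv_integrable.
- by move=> y _; rewrite /g lerBlDr lerDl sqr_ge0.
Qed.

Lemma Rintegral_itv_cc_split f a1 a2 m : a1 <= m <= a2 ->
  mu.-integrable `[a1, a2] (EFin \o f) ->
  \int[mu]_(y in `[a1, a2]) f y =
  \int[mu]_(y in `[a1, m]) f y + \int[mu]_(y in `[m, a2]) f y.
Proof.
move=> /andP[a1m ma2] fi.
have := Rintegral_itvB fi (x := m); rewrite !bnd_simp => /(_ a1m ma2).
move/eqP; rewrite subr_eq => /eqP ->; rewrite addrC; congr (_ + _).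
apply: Rintegral_itv_obnd_cbnd.
apply: integrableS fi => //; apply: subset_itv; rewrite bnd_simp//.
Qed.

(** Each half of the interval gets a tangent weight centred at its outer end. The boundary terms
    then vanish, at the outer end because [tan 0 = 0] and at the midpoint because [w] does, and
    [b * l < pi] keeps the argument of the tangent below a quarter period on a half of length
    [l / 2]. *)
Lemma midpoint_poincare w dw a l b :
  (forall y, is_derive y 1 w (dw y)) -> continuous dw -> 0 < l ->
  0 < b -> b * l < pi -> w (a + l / 2) = 0 ->
  b ^+ 2 * \int[mu]_(y in `[a, a + l]) w y ^+ 2 <=
  \int[mu]_(y in `[a, a + l]) dw y ^+ 2.
Proof.
move=> wdw cdw l0 b0 bl w0.
have cw := is_derive_continuous wdw.
have cw2 : continuous (fun y => w y ^+ 2) by move=> y; apply: cvg_sqr; exact: cw.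
have cdw2 : continuous (fun y => dw y ^+ 2) by move=> y; apply: cvg_sqr; exact: cdw.
have cbw2 : continuous (fun y => b ^+ 2 * w y ^+ 2).
  by move=> y; apply: cvgM; [exact: cvg_cst|exact: cw2].
rewrite -RintegralZl//; last exact: continuous_itv_integrable.
rewrite -subr_ge0 -RintegralB//; [|exact: continuous_itv_integrable..].
have pi0 := @pi_gt0 R.
rewrite (@Rintegral_itv_cc_split _ _ _ (a + l / 2)); first last.
- apply: (@continuous_itv_integrable (fun y => dw y ^+ 2 - b ^+ 2 * w y ^+ 2)).
  by move=> y; apply: cvgB; [exact: cdw2|exact: cbw2].
- by apply/andP; split; lra.
apply: addr_ge0.
- apply: le_trans (tan_weight_le (b := b) (c := a) wdw cdw _ _).
  + by rewrite w0 subrr mulr0 tan0 !(mulr0, expr0n, mul0r) subrr.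
  + lra.
  + move=> y /andP[ay ya].
    have : 0 <= b * (y - a) by rewrite mulr_ge0 ?subr_ge0// ltW.
    have : b * (y - a) <= b * (l / 2) by rewrite ler_pM2l//; lra.
    move=> *; apply/andP; split; lra.
- apply: le_trans (tan_weight_le (b := b) (c := a + l) wdw cdw _ _).
  + by rewrite w0 subrr mulr0 tan0 !(mulr0, expr0n, mul0r) subrr.
  + lra.
  + move=> y /andP[ay ya].
    have : 0 <= b * (a + l - y) by rewrite mulr_ge0 ?subr_ge0// ltW.
    have : b * (a + l - y) <= b * (l / 2) by rewrite ler_pM2l//; lra.
    move=> *; apply/andP; split; lra.
Qed.

(** Subtracting the value [k] at the midpoint reduces this to [midpoint_poincare]. The mean
    minimizes the squared distance to constants, so replacing [k] by the mean only decreases the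
    left-hand side; the difference is [(T - l * k) ^ 2 / l]. *)
Lemma wirtinger w dw a l b :
  (forall y, is_derive y 1 w (dw y)) -> continuous dw -> 0 < l ->
  0 < b -> b * l < pi ->
  b ^+ 2 * (\int[mu]_(y in `[a, a + l]) w y ^+ 2 -
     (\int[mu]_(y in `[a, a + l]) w y) ^+ 2 / l) <=
  \int[mu]_(y in `[a, a + l]) dw y ^+ 2.
Proof.
move=> wdw cdw l0 b0 bl.
set k := w (a + l / 2).
have dwk y : is_derive y 1 (fun y => w y - k) (dw y).
  have wy := wdw y; have := is_deriveB wy (is_derive_cst k y 1).
  by rewrite subr0.
apply: le_trans (midpoint_poincare (b := b) (a := a) dwk cdw l0 b0 bl _); last first.
  by rewrite subrr.
have cw := is_derive_continuous wdw.
have cw2 : continuous (fun y => w y ^+ 2) by move=> y; apply: cvg_sqr; exact: cw.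
have ckw : continuous (fun y => 2 * k * w y).
  by move=> y; apply: cvgM; [exact: cvg_cst|exact: cw].
rewrite ler_pM2l ?exprn_gt0//.
under [in leRHS]eq_Rintegral => y _.
  rewrite (_ : (w y - k) ^+ 2 = w y ^+ 2 - 2 * k * w y + k ^+ 2); last by ring.
  over.
rewrite RintegralD//; last 2 first.
- apply: (@continuous_itv_integrable (fun y => w y ^+ 2 - 2 * k * w y)).
  by move=> y; apply: cvgB; [exact: cw2|exact: ckw].
- by apply: (@continuous_itv_integrable (fun=> k ^+ 2)) => y; exact: cvg_cst.
rewrite RintegralB//; [|exact: continuous_itv_integrable..].
rewrite RintegralZl//; last exact: continuous_itv_integrable.
rewrite Rintegral_cst//= lebesgue_measure_itv/= lte_fin ltrDl l0 -EFinB/=.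
set A := \int[mu]_(_ in _) _ ; set T := \int[mu]_(_ in _) _.
rewrite (addrC a) addrK -addrA lerD2l -subr_ge0.
rewrite (_ : _ - _ = (T - l * k) ^+ 2 / l); first by rewrite divr_ge0 ?sqr_ge0// ltW.
by field; rewrite gt_eqF.
Qed.

End one_dimensional.

(** * Fubini for bounded functions on rectangles *)

(** On rectangles of finite measure, boundedness passes to every slice and to partial integrals,
    with no exceptional null set. Fubini can thus be applied repeatedly to real-valued integrals,
    and partial integrals can be squared and integrated again. *)
Definition bounded_mfun d (T : measurableType d) (R : realType) (D : set T)
    (F : T -> R) : Prop :=
  measurable_fun D F /\ exists C, forall p, D p -> `|F p| <= C.

Section bounded_mfun.
Context d (T : measurableType d) (R : realType).
Implicit Types (D : set T) (F G : T -> R).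

Lemma bounded_mfun_cst D (c : R) : bounded_mfun D (fun=> c).
Proof. by split; [exact: measurable_cst|exists `|c|]. Qed.

Lemma bounded_mfunM D F G :
  bounded_mfun D F -> bounded_mfun D G -> bounded_mfun D (fun p => F p * G p).
Proof.
move=> [mF [C FC]] [mG [C' GC]]; split; first exact: measurable_funM.
by exists (C * C') => p Dp; rewrite normrM ler_pM ?FC ?GC.
Qed.

Lemma bounded_mfunB D F G :
  bounded_mfun D F -> bounded_mfun D G -> bounded_mfun D (fun p => F p - G p).
Proof.
move=> [mF [C FC]] [mG [C' GC]]; split; first exact: measurable_funB.
exists (C + C') => p Dp; rewrite (le_trans (ler_normB _ _))//.
by rewrite lerD ?FC ?GC.
Qed.

Lemma bounded_mfunX2 D F : bounded_mfun D F -> bounded_mfun D (fun p => F p ^+ 2).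
Proof. by move=> bF; exact: (bounded_mfunM bF bF). Qed.

Lemma bounded_mfunS D E F : measurable D -> E `<=` D ->
  bounded_mfun D F -> bounded_mfun E F.
Proof.
move=> mD ED [mF [C FC]]; split; first exact: measurable_funS mF.
by exists C => p /ED/FC.
Qed.

Lemma bounded_mfun_integrable (m : {measure set T -> \bar R}) D F :
  measurable D -> (m D < +oo)%E -> bounded_mfun D F ->
  m.-integrable D (EFin \o F).
Proof.
move=> mD Doo [mF [C FC]]; apply: measurable_bounded_integrable => //.
exists C; split; first exact: num_real.
by move=> M CM p Dp /=; exact: le_trans (FC _ Dp) (ltW CM).
Qed.

End bounded_mfun.

Section rectangle.
Context d1 d2 (T1 : measurableType d1) (T2 : measurableType d2) (R : realType).
Variables (m1 : {sigma_finite_measure set T1 -> \bar R}).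
Variables (m2 : {sigma_finite_measure set T2 -> \bar R}).
Variables (A : set T1) (B : set T2) (al be : R).
Implicit Types (F : T1 * T2 -> R) (x : T1) (y : T2).
Hypotheses (mA : measurable A) (mB : measurable B).
Hypotheses (m1A : m1 A = al%:E) (m2B : m2 B = be%:E).

Let mAB : measurable (A `*` B). Proof. exact: measurableX. Qed.

Let ABoo : ((m1 \x m2)%E (A `*` B) < +oo)%E.
Proof. by rewrite product_measure1E// [X in (X * _)%E]m1A [X in (_ * X)%E]m2B ltry. Qed.

Let Aoo : (m1 A < +oo)%E. Proof. by rewrite m1A ltry. Qed.
Let Boo : (m2 B < +oo)%E. Proof. by rewrite m2B ltry. Qed.

Lemma bounded_mfun_slice1 F x : bounded_mfun (A `*` B) F -> A x ->
  bounded_mfun B (fun y => F (x, y)).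
Proof.
move=> [mF [C FC]] Ax; split; last by exists C => y By; apply: FC.
apply: (@measurable_comp _ _ _ _ _ _ (A `*` B) F B (pair x)) => //.
  by move=> _ [y By <-].
exact: measurable_funTS.
Qed.

Lemma bounded_mfun_slice2 F y : bounded_mfun (A `*` B) F -> B y ->
  bounded_mfun A (fun x => F (x, y)).
Proof.
move=> [mF [C FC]] By; split; last by exists C => x Ax; apply: FC.
apply: (@measurable_comp _ _ _ _ _ _ (A `*` B) F A (pair^~ y)) => //.
  by move=> _ [x Ax <-].
exact: measurable_funTS.
Qed.

Lemma bounded_mfun_fst (f : T1 -> R) : bounded_mfun A f ->
  bounded_mfun (A `*` B) (fun p => f p.1).
Proof.
move=> [mf [C fC]]; split; last by exists C => p [? _]; apply: fC.
apply: (@measurable_comp _ _ _ _ _ _ A f (A `*` B) fst) => //.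
  by move=> _ [p [? _] <-].
exact: (measurable_funTS measurable_fst).
Qed.

Lemma bounded_mfun_snd (f : T2 -> R) : bounded_mfun B f ->
  bounded_mfun (A `*` B) (fun p => f p.2).
Proof.
move=> [mf [C fC]]; split; last by exists C => p [_ ?]; apply: fC.
apply: (@measurable_comp _ _ _ _ _ _ B f (A `*` B) snd) => //.
  by move=> _ [p [_ ?] <-].
exact: (measurable_funTS measurable_snd).
Qed.

(** Fubini on the full product is applied to [F] extended by zero; the partial integral of the
    extension is the extension of the partial integral. *)
Lemma bounded_mfun_Fubini12 F : bounded_mfun (A `*` B) F ->
  bounded_mfun A (fun x => \int[m2]_(y in B) F (x, y)) /\
  \int[(m1 \x m2)%E]_(p in A `*` B) F p =
  \int[m1]_(x in A) \int[m2]_(y in B) F (x, y).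
Proof.
move=> bF; pose f := (EFin \o F) \_ (A `*` B).
have fi : (m1 \x m2)%E.-integrable setT f.
  exact/(integrable_mkcond _ mAB).1/bounded_mfun_integrable.
have fE : fubini_F m2 f =
    (EFin \o fun x => \int[m2]_(y in B) F (x, y)) \_ A.
  apply/funext => x; rewrite /fubini_F patchE; case: ifPn => xA; last first.
    rewrite integral0_eq// => y _; rewrite /f patchE ifF//.
    by apply/negbTE/negP; rewrite inE => -[/= Ax _]; move/negP: xA; rewrite inE.
  rewrite inE in xA.
  rewrite [RHS]fineK; last first.
    apply: integrable_fin_num => //.
    exact: bounded_mfun_integrable (bounded_mfun_slice1 bF xA).
  rewrite [RHS]integral_mkcond; apply: eq_integral => y _.
  rewrite /f !patchE; congr (if _ then _ else _).
  by apply/idP/idP; rewrite !inE/=; [case|].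
split.
  split.
    apply/measurable_EFinP/(measurable_restrictT _ mA).2.
    by rewrite -fE; exact: measurable_fubini_F fi.
  have [mF [C FC]] := bF; exists (C * be) => x Ax.
  have bx := bounded_mfun_slice1 bF Ax.
  have ix := bounded_mfun_integrable mB Boo bx.
  rewrite (le_trans (le_normr_Rintegral _ _))//.
  rewrite (_ : be = fine (m2 B)); last by rewrite m2B.
  rewrite -Rintegral_cst//; apply: le_Rintegral => //.
  - exact: integrable_norm.
  - by apply: bounded_mfun_integrable => //; exact: bounded_mfun_cst.
  - by move=> y By; exact: FC.
rewrite /Rintegral; congr fine; rewrite integral_mkcond -/f.
rewrite -integral12_prod_meas1// fE [RHS]integral_mkcond; apply: eq_integral => x _.
by rewrite !patchE.
Qed.

Lemma bounded_mfun_Fubini21 F : bounded_mfun (A `*` B) F ->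
  bounded_mfun B (fun y => \int[m1]_(x in A) F (x, y)) /\
  \int[(m1 \x m2)%E]_(p in A `*` B) F p =
  \int[m2]_(y in B) \int[m1]_(x in A) F (x, y).
Proof.
move=> bF; pose f := (EFin \o F) \_ (A `*` B).
have fi : (m1 \x m2)%E.-integrable setT f.
  exact/(integrable_mkcond _ mAB).1/bounded_mfun_integrable.
have fE : fubini_G m1 f =
    (EFin \o fun y => \int[m1]_(x in A) F (x, y)) \_ B.
  apply/funext => y; rewrite /fubini_G patchE; case: ifPn => yB; last first.
    rewrite integral0_eq// => x _; rewrite /f patchE ifF//.
    by apply/negbTE/negP; rewrite inE => -[/= _ By]; move/negP: yB; rewrite inE.
  rewrite inE in yB.
  rewrite [RHS]fineK; last first.
    apply: integrable_fin_num => //.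
    exact: bounded_mfun_integrable (bounded_mfun_slice2 bF yB).
  rewrite [RHS]integral_mkcond; apply: eq_integral => x _.
  rewrite /f !patchE; congr (if _ then _ else _).
  by apply/idP/idP; rewrite !inE/=; [case|].
split.
  split.
    apply/measurable_EFinP/(measurable_restrictT _ mB).2.
    by rewrite -fE; exact: measurable_fubini_G fi.
  have [mF [C FC]] := bF; exists (C * al) => y By.
  have bx := bounded_mfun_slice2 bF By.
  have ix := bounded_mfun_integrable mA Aoo bx.
  rewrite (le_trans (le_normr_Rintegral _ _))//.
  rewrite (_ : al = fine (m1 A)); last by rewrite m1A.
  rewrite -Rintegral_cst//; apply: le_Rintegral => //.
  - exact: integrable_norm.
  - by apply: bounded_mfun_integrable => //; exact: bounded_mfun_cst.
  - by move=> x Ax; exact: FC.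
rewrite /Rintegral; congr fine; rewrite integral_mkcond -/f.
rewrite -integral21_prod_meas1// fE [RHS]integral_mkcond; apply: eq_integral => y _.
by rewrite !patchE.
Qed.

End rectangle.

(** * Borel measurability in the plane *)

Section plane.
Context {R : realType}.
Notation mu := (@lebesgue_measure R).
Notation nu := (@plane_measure R).

(** The measurable sets of the plane are those of the product sigma-algebra, so an open set is
    written as a countable union of open rectangles with rational ends. *)
Lemma plane_open_measurable (U : set (R * R)) : open U -> measurable U.
Proof.
move=> oU.
pose rect (a b c d : rat) : set (R * R) :=
  `]ratr a, ratr b[%classic `*` `]ratr c, ratr d[%classic.
have -> : U = \bigcup_a \bigcup_b \bigcup_c \bigcup_d
    (if pselect (rect a b c d `<=` U) then rect a b c d else set0).
  apply/seteqP; split=> [[x y] Uxy|p]; last first.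
    by move=> [a _ [b _ [c _ [d _]]]]; case: pselect => [rU /rU|_ []].
  have /nbhs_ballP[e /= e0 eU] : nbhs (x, y) U by exact: open_nbhs_nbhs.
  have /rat_in_itvoo[a ax] : x - e < x by lra.
  have /rat_in_itvoo[b bx] : x < x + e by lra.
  have /rat_in_itvoo[c cy] : y - e < y by lra.
  have /rat_in_itvoo[d dy] : y < y + e by lra.
  move: ax bx cy dy; rewrite !in_itv/=.
  move=> /andP[a1 a2] /andP[b1 b2] /andP[c1 c2] /andP[d1 d2].
  exists a => //; exists b => //; exists c => //; exists d => //.
  case: pselect => [rU|]; first by split; rewrite /= in_itv/=; apply/andP.
  case; move=> [x' y'] [/=]; rewrite !in_itv/= => /andP[x1 x2] /andP[y1 y2].
  by apply: eU; split; rewrite /ball/= ltr_distl; apply/andP; split; lra.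
apply: bigcupT_measurable_rat => a; apply: bigcupT_measurable_rat => b.
apply: bigcupT_measurable_rat => c; apply: bigcupT_measurable_rat => d.
case: pselect => rU; last exact: measurable0.
by apply: measurableX; exact: measurable_itv.
Qed.

Lemma plane_continuous_measurable (f : R * R -> R) :
  continuous f -> measurable_fun setT f.
Proof.
move=> /continuousP cf; apply: (measurability _ (RGenOpens.measurableE R)).
move=> _ [_ [a [b ->] <-]]; rewrite setTI; apply: plane_open_measurable.
exact/cf/interval_open.
Qed.

End plane.

(** * Variances on a product space *)

Section efron_stein.
Context d1 d2 (T1 : measurableType d1) (T2 : measurableType d2) (R : realType).
Variables (m1 : {sigma_finite_measure set T1 -> \bar R}).
Variables (m2 : {sigma_finite_measure set T2 -> \bar R}).
Variables (A : set T1) (B : set T2) (al be : R).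
Implicit Types (F : T1 * T2 -> R).
Hypotheses (mA : measurable A) (mB : measurable B).
Hypotheses (m1A : m1 A = al%:E) (m2B : m2 B = be%:E).
Hypotheses (al0 : 0 < al) (be0 : 0 < be).

Lemma Rintegral_variance d (T : measurableType d)
    (m : {measure set T -> \bar R}) (D : set T) (c : R) (g : T -> R) :
  measurable D -> m D = c%:E -> 0 < c -> bounded_mfun D g ->
  \int[m]_(x in D) (g x - (\int[m]_(x in D) g x) / c) ^+ 2 =
  \int[m]_(x in D) g x ^+ 2 - (\int[m]_(x in D) g x) ^+ 2 / c.
Proof.
move=> mD mDc c0 bg.
have Doo : (m D < +oo)%E by rewrite mDc ltry.
have bi (f : T -> R) : bounded_mfun D f -> m.-integrable D (EFin \o f).
  exact: bounded_mfun_integrable.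
set I := \int[m]_(x in D) g x; pose k := I / c.
have bkg : bounded_mfun D (fun x => 2 * k * g x).
  by apply: bounded_mfunM => //; exact: bounded_mfun_cst.
have bk : bounded_mfun D (fun=> k ^+ 2) by exact: bounded_mfun_cst.
have bg2 := bounded_mfunX2 bg.
transitivity (\int[m]_(x in D) (g x ^+ 2 - (2 * k * g x - k ^+ 2))).
  by apply: eq_Rintegral => x _; rewrite /k; ring.
rewrite RintegralB//; [|exact: bi|by apply: bi; exact: bounded_mfunB].
rewrite RintegralB//; [|exact: bi..].
rewrite RintegralZl//; last exact: bi.
rewrite Rintegral_cst// mDc/= -/I /k; field.
by rewrite gt_eqF.
Qed.

Let mAB : measurable (A `*` B). Proof. exact: measurableX. Qed.

Let Aoo : (m1 A < +oo)%E. Proof. by rewrite m1A ltry. Qed.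
Let Boo : (m2 B < +oo)%E. Proof. by rewrite m2B ltry. Qed.

Lemma Rintegral_variance12 F : bounded_mfun (A `*` B) F ->
  \int[(m1 \x m2)%E]_(p in A `*` B)
     (F p - (\int[m2]_(y in B) F (p.1, y)) / be) ^+ 2 =
  \int[(m1 \x m2)%E]_(p in A `*` B) F p ^+ 2 -
  (\int[m1]_(x in A) (\int[m2]_(y in B) F (x, y)) ^+ 2) / be.
Proof.
move=> bF.
have [bP _] := bounded_mfun_Fubini12 mA mB m1A m2B bF.
have bFP : bounded_mfun (A `*` B)
    (fun p => F p - (\int[m2]_(y in B) F (p.1, y)) / be).
  apply: bounded_mfunB => //; apply: bounded_mfunM; last exact: bounded_mfun_cst.
  exact: bounded_mfun_fst bP.
have [_ ->] := bounded_mfun_Fubini12 mA mB m1A m2B (bounded_mfunX2 bFP).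
have [bF2 ->] := bounded_mfun_Fubini12 mA mB m1A m2B (bounded_mfunX2 bF).
under eq_Rintegral => x xA.
  rewrite /= (Rintegral_variance mB m2B be0); last first.
    by apply: bounded_mfun_slice1 bF _; rewrite inE in xA.
  over.
have bP2 := bounded_mfunX2 bP.
rewrite RintegralB//; first last.
- apply: bounded_mfun_integrable => //.
  by apply: bounded_mfunM bP2 _; exact: bounded_mfun_cst.
- exact: bounded_mfun_integrable.
by congr (_ - _); rewrite RintegralZr//; exact: bounded_mfun_integrable.
Qed.

Lemma Rintegral_variance21 F : bounded_mfun (A `*` B) F ->
  \int[(m1 \x m2)%E]_(p in A `*` B)
     (F p - (\int[m1]_(x in A) F (x, p.2)) / al) ^+ 2 =
  \int[(m1 \x m2)%E]_(p in A `*` B) F p ^+ 2 -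
  (\int[m2]_(y in B) (\int[m1]_(x in A) F (x, y)) ^+ 2) / al.
Proof.
move=> bF.
have [bQ _] := bounded_mfun_Fubini21 mA mB m1A m2B bF.
have bFQ : bounded_mfun (A `*` B)
    (fun p => F p - (\int[m1]_(x in A) F (x, p.2)) / al).
  apply: bounded_mfunB => //; apply: bounded_mfunM; last exact: bounded_mfun_cst.
  exact: bounded_mfun_snd bQ.
have [_ ->] := bounded_mfun_Fubini21 mA mB m1A m2B (bounded_mfunX2 bFQ).
have [bF2 ->] := bounded_mfun_Fubini21 mA mB m1A m2B (bounded_mfunX2 bF).
under eq_Rintegral => y yB.
  rewrite /= (Rintegral_variance mA m1A al0); last first.
    by apply: bounded_mfun_slice2 bF _; rewrite inE in yB.
  over.
have bQ2 := bounded_mfunX2 bQ.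
rewrite RintegralB//; first last.
- apply: bounded_mfun_integrable => //.
  by apply: bounded_mfunM bQ2 _; exact: bounded_mfun_cst.
- exact: bounded_mfun_integrable.
by congr (_ - _); rewrite RintegralZr//; exact: bounded_mfun_integrable.
Qed.

(** With [P], [Q] the partial integrals and [T] the total, this is the nonnegativity of the integral
    of the square of [F - P / be - Q / al + T / (al * be)], obtained by removing the mean in one
    variable and then in the other. Equivalently, the variances along the two directions add up to
    at least the full variance, which leads from intervals to squares without eigenfunction
    expansions. *)
Lemma efron_stein F : bounded_mfun (A `*` B) F ->
  (\int[m1]_(x in A) (\int[m2]_(y in B) F (x, y)) ^+ 2) / be +
  (\int[m2]_(y in B) (\int[m1]_(x in A) F (x, y)) ^+ 2) / al <=
  \int[(m1 \x m2)%E]_(p in A `*` B) F p ^+ 2 +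
  (\int[(m1 \x m2)%E]_(p in A `*` B) F p) ^+ 2 / (al * be).
Proof.
move=> bF.
have [bP TP] := bounded_mfun_Fubini12 mA mB m1A m2B bF.
have [bQ TQ] := bounded_mfun_Fubini21 mA mB m1A m2B bF.
set T := \int[_]_(p in _) F p in TP TQ *.
set P := fun x => \int[m2]_(y in B) F (x, y) in bP TP *.
set Q := fun y => \int[m1]_(x in A) F (x, y) in bQ TQ *.
pose D p := F p - P p.1 / be.
have bD : bounded_mfun (A `*` B) D.
  apply: bounded_mfunB => //; apply: bounded_mfunM; last exact: bounded_mfun_cst.
  exact: bounded_mfun_fst bP.
have QD y : y \in B -> \int[m1]_(x in A) D (x, y) = Q y - T / be.
  rewrite inE => yB; rewrite /D RintegralB//=; first last.
  - apply: bounded_mfun_integrable => //.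
    by apply: bounded_mfunM bP _; exact: bounded_mfun_cst.
  - apply: bounded_mfun_integrable => //; exact: bounded_mfun_slice2 bF yB.
  by rewrite RintegralZr//; [rewrite TP|exact: bounded_mfun_integrable].
have : 0 <= \int[(m1 \x m2)%E]_(p in A `*` B)
     (D p - (\int[m1]_(x in A) D (x, p.2)) / al) ^+ 2.
  by apply: Rintegral_ge0 => *; exact: sqr_ge0.
have QD2 y : y \in B -> (\int[m1]_(x in A) D (x, y)) ^+ 2 = (Q y - T / be) ^+ 2.
  by move=> /QD ->.
rewrite Rintegral_variance21// [in X in X / al](eq_Rintegral _ QD2).
rewrite TQ (Rintegral_variance mB m2B be0 bQ) -TQ Rintegral_variance12//.
rewrite -/P -/Q.
set X := \int[_]_(p in _) _; set Y := \int[_]_(_ in _) _; set Z := \int[_]_(_ in _) _.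
have -> : (Z - T ^+ 2 / be) / al = Z / al - T ^+ 2 / (al * be).
  by field; rewrite !gt_eqF.
by move=> ?; lra.
Qed.

End efron_stein.

(** * Squares *)

Section squares.
Context {R : realType}.
Notation mu := (@lebesgue_measure R).
Notation nu := (@plane_measure R).
Implicit Types (phi : R * R -> R) (U : set (R * R)).

(* What the argument needs of a test function: unlike [test_function], this is
   visibly stable under linear combinations. *)
Record C1_function U phi phi1 phi2 : Prop := C1Function {
  C1_bounded : bounded_mfun setT phi;
  C1_bounded1 : bounded_mfun setT phi1;
  C1_bounded2 : bounded_mfun setT phi2;
  C1_derive1 : forall x y : R,
    is_derive x (1 : R) (fun x : R => phi (x, y)) (phi1 (x, y));
  C1_derive2 : forall x y : R,
    is_derive y (1 : R) (fun y : R => phi (x, y)) (phi2 (x, y));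
  C1_continuous1 : forall y : R, continuous (fun x : R => phi1 (x, y));
  C1_continuous2 : forall x : R, continuous (fun y : R => phi2 (x, y));
  C1_vanish : forall p, ~ U p -> [/\ phi p = 0, phi1 p = 0 & phi2 p = 0];
  C1_support : exists M : R, forall p, ~ (`|p.1| < M /\ `|p.2| < M) ->
    [/\ phi p = 0, phi1 p = 0 & phi2 p = 0]
}.

Lemma lebesgue_measure_itvco (a l : R) : 0 < l -> mu `[a, a + l[%classic = l%:E.
Proof.
by move=> l0; rewrite lebesgue_measure_itv/= lte_fin ltrDl l0 -EFinB addrAC subrr add0r.
Qed.

(** Half-open, so that the squares of a grid are disjoint and leave no gap; the one-dimensional
    bounds, on closed intervals, are reached through [Rintegral_itv_co_cc]. *)
Definition square (a c l : R) : set (R * R) :=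
  `[a, a + l[%classic `*` `[c, c + l[%classic.

Lemma measurable_square a c l : measurable (square a c l).
Proof. by apply: measurableX; exact: measurable_itv. Qed.

Lemma Rintegral_itv_co_cc (a l : R) (f : R -> R) : continuous f ->
  \int[mu]_(x in `[a, a + l[) f x = \int[mu]_(x in `[a, a + l]) f x.
Proof.
move=> cf; apply: Rintegral_itv_bndo_bndc.
apply: integrableS (continuous_itv_integrable a (a + l) cf) => //.
by apply: subset_itv; rewrite bnd_simp.
Qed.

(** [wirtinger] on each vertical segment, integrated over the abscissa; [square_horizontal] is the
    mirror image. *)
Lemma square_vertical U phi phi1 phi2 (a c l b : R) :
  C1_function U phi phi1 phi2 -> 0 < l -> 0 < b -> b * l < pi ->
  b ^+ 2 * (\int[nu]_(p in square a c l) phi p ^+ 2 -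
     (\int[mu]_(x in `[a, a + l[)
        (\int[mu]_(y in `[c, c + l[) phi (x, y)) ^+ 2) / l) <=
  \int[nu]_(p in square a c l) phi2 p ^+ 2.
Proof.
move=> C1 l0 b0 bl.
have mI x : measurable (`[x, x + l[%classic : set R) by exact: measurable_itv.
have Il x := lebesgue_measure_itvco x l0.
have Ioo x : (mu `[x, (x + l)%R[%classic < +oo)%E by rewrite Il ltry.
have Iaoo := Ioo a; have Icoo := Ioo c.
have bS f : bounded_mfun setT f ->
    bounded_mfun (square a c l : set (R * R)) (f : R * R -> R).
  by move=> bf; exact: bounded_mfunS bf.
have bphi := bS _ (C1_bounded C1); have bphi2 := bS _ (C1_bounded2 C1).
have F12 := bounded_mfun_Fubini12 (m1 := mu) (m2 := mu) (mI a) (mI c) (Il a) (Il c).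
have [bP _] := F12 _ bphi.
have [bX XE] := F12 _ (bounded_mfunX2 bphi).
have [bY YE] := F12 _ (bounded_mfunX2 bphi2).
have bPP := bounded_mfunX2 bP.
have bP2 : bounded_mfun `[a, a + l[%classic
    (fun x => (\int[mu]_(y in `[c, c + l[) phi (x, y)) ^+ 2 / l).
  by apply: bounded_mfunM bPP _; exact: bounded_mfun_cst.
rewrite [X in b ^+ 2 * (X - _)]XE [leRHS]YE -RintegralZr//; last first.
  by apply: bounded_mfun_integrable => //; exact: bPP.
rewrite -RintegralB//; [|exact: bounded_mfun_integrable..].
have bXP := bounded_mfunB bX bP2.
rewrite -RintegralZl//; last exact: bounded_mfun_integrable.
apply: le_Rintegral => //.
- apply: bounded_mfun_integrable => //.
  by apply: (bounded_mfunM _ bXP); exact: bounded_mfun_cst.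
- exact: bounded_mfun_integrable.
- move=> x _.
  have d2 := C1_derive2 C1 x.
  have c2 : continuous (fun y : R => phi2 (x, y)) by exact: (C1_continuous2 C1).
  have cx := @is_derive_continuous R (fun y => phi (x, y)) (fun y => phi2 (x, y)) d2.
  rewrite !Rintegral_itv_co_cc//; last first.
  - by move=> y; apply: cvg_sqr; exact: cx.
  - by move=> y; apply: cvg_sqr; exact: c2.
  exact: (@wirtinger R (fun y => phi (x, y)) (fun y => phi2 (x, y))).
Qed.

Lemma square_horizontal U phi phi1 phi2 (a c l b : R) :
  C1_function U phi phi1 phi2 -> 0 < l -> 0 < b -> b * l < pi ->
  b ^+ 2 * (\int[nu]_(p in square a c l) phi p ^+ 2 -
     (\int[mu]_(y in `[c, c + l[)
        (\int[mu]_(x in `[a, a + l[) phi (x, y)) ^+ 2) / l) <=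
  \int[nu]_(p in square a c l) phi1 p ^+ 2.
Proof.
move=> C1 l0 b0 bl.
have mI x : measurable (`[x, x + l[%classic : set R) by exact: measurable_itv.
have Il x := lebesgue_measure_itvco x l0.
have Ioo x : (mu `[x, (x + l)%R[%classic < +oo)%E by rewrite Il ltry.
have Iaoo := Ioo a; have Icoo := Ioo c.
have bS f : bounded_mfun setT f ->
    bounded_mfun (square a c l : set (R * R)) (f : R * R -> R).
  by move=> bf; exact: bounded_mfunS bf.
have bphi := bS _ (C1_bounded C1); have bphi1 := bS _ (C1_bounded1 C1).
have F21 := bounded_mfun_Fubini21 (m1 := mu) (m2 := mu) (mI a) (mI c) (Il a) (Il c).
have [bP _] := F21 _ bphi.
have [bX XE] := F21 _ (bounded_mfunX2 bphi).
have [bY YE] := F21 _ (bounded_mfunX2 bphi1).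
have bPP := bounded_mfunX2 bP.
have bP2 : bounded_mfun `[c, c + l[%classic
    (fun y => (\int[mu]_(x in `[a, a + l[) phi (x, y)) ^+ 2 / l).
  by apply: bounded_mfunM bPP _; exact: bounded_mfun_cst.
rewrite [X in b ^+ 2 * (X - _)]XE [leRHS]YE -RintegralZr//; last first.
  by apply: bounded_mfun_integrable => //; exact: bPP.
rewrite -RintegralB//; [|exact: bounded_mfun_integrable..].
have bXP := bounded_mfunB bX bP2.
rewrite -RintegralZl//; last exact: bounded_mfun_integrable.
apply: le_Rintegral => //.
- apply: bounded_mfun_integrable => //.
  by apply: (bounded_mfunM _ bXP); exact: bounded_mfun_cst.
- exact: bounded_mfun_integrable.
- move=> y _.
  have d1 x := C1_derive1 C1 x y.
  have c1 : continuous (fun x : R => phi1 (x, y)) by exact: (C1_continuous1 C1).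
  have cy := @is_derive_continuous R (fun x => phi (x, y)) (fun x => phi1 (x, y)) d1.
  rewrite !Rintegral_itv_co_cc//; last first.
  - by move=> x; apply: cvg_sqr; exact: cy.
  - by move=> x; apply: cvg_sqr; exact: c1.
  exact: (@wirtinger R (fun x => phi (x, y)) (fun x => phi1 (x, y))).
Qed.

(** The two directional bounds are added and [efron_stein] bounds the sum of the directional
    variances from below, so that a square has the same constant [b] as an interval of length
    [l]. *)
Lemma square_poincare U phi phi1 phi2 (a c l b : R) :
  C1_function U phi phi1 phi2 -> 0 < l -> 0 < b -> b * l < pi ->
  b ^+ 2 * (\int[nu]_(p in square a c l) phi p ^+ 2 -
     (\int[nu]_(p in square a c l) phi p) ^+ 2 / l ^+ 2) <=
  \int[nu]_(p in square a c l) phi1 p ^+ 2 +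
  \int[nu]_(p in square a c l) phi2 p ^+ 2.
Proof.
move=> C1 l0 b0 bl.
have mI x : measurable (`[x, x + l[%classic : set R) by exact: measurable_itv.
have Il x := lebesgue_measure_itvco x l0.
have bphi : bounded_mfun (square a c l) phi.
  by apply: bounded_mfunS (C1_bounded C1).
have := efron_stein (m1 := mu) (m2 := mu) (mI a) (mI c) (Il a) (Il c) l0 l0 bphi.
have := square_vertical a c C1 l0 b0 bl; have := square_horizontal a c C1 l0 b0 bl.
rewrite -/nu -/(square a c l) -expr2.
set P := \int[mu]_(x in _) _ ; set Q := \int[mu]_(x in _) _.
set X := \int[_]_(p in _) _ ; set Y1 := \int[_]_(p in _) _.
set Y2 := \int[_]_(p in _) phi2 _ ^+ 2.
set T := \int[_]_(p in _) _.
move=> h1 h2 E.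
apply: le_trans (lerD h1 h2); rewrite -mulrDr ler_pM2l ?exprn_gt0//.
have : Q / l + P / l <= X + T ^+ 2 / l ^+ 2 := E.
by move=> ?; lra.
Qed.

(** Every vertical segment of the square has its midpoint on the midline, so [midpoint_poincare]
    applies slice by slice and the vertical derivative alone controls [phi]. *)
Lemma square_midline U phi phi1 phi2 (a c l b : R) :
  C1_function U phi phi1 phi2 -> 0 < l -> 0 < b -> b * l < pi ->
  (forall x, a <= x -> phi (x, c + l / 2) = 0) ->
  b ^+ 2 * \int[nu]_(p in square a c l) phi p ^+ 2 <=
  \int[nu]_(p in square a c l) phi2 p ^+ 2.
Proof.
move=> C1 l0 b0 bl phi0.
have mI x : measurable (`[x, x + l[%classic : set R) by exact: measurable_itv.
have Il x := lebesgue_measure_itvco x l0.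
have Ioo x : (mu `[x, (x + l)%R[%classic < +oo)%E by rewrite Il ltry.
have Iaoo := Ioo a; have Icoo := Ioo c.
have bS f : bounded_mfun setT f ->
    bounded_mfun (square a c l : set (R * R)) (f : R * R -> R).
  by move=> bf; exact: bounded_mfunS bf.
have bphi := bS _ (C1_bounded C1); have bphi2 := bS _ (C1_bounded2 C1).
have F12 := bounded_mfun_Fubini12 (m1 := mu) (m2 := mu) (mI a) (mI c) (Il a) (Il c).
have [bX XE] := F12 _ (bounded_mfunX2 bphi).
have [bY YE] := F12 _ (bounded_mfunX2 bphi2).
rewrite [X in b ^+ 2 * X]XE [leRHS]YE -RintegralZl//; last first.
  exact: bounded_mfun_integrable.
apply: le_Rintegral => //.
- apply: bounded_mfun_integrable => //.
  by apply: (bounded_mfunM _ bX); exact: bounded_mfun_cst.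
- exact: bounded_mfun_integrable.
- move=> x; rewrite /= in_itv/= => /andP[ax _].
  have d2 := C1_derive2 C1 x.
  have c2 : continuous (fun y : R => phi2 (x, y)) by exact: (C1_continuous2 C1).
  have cx := @is_derive_continuous R (fun y => phi (x, y)) (fun y => phi2 (x, y)) d2.
  rewrite !Rintegral_itv_co_cc//; last first.
  - by move=> y; apply: cvg_sqr; exact: cx.
  - by move=> y; apply: cvg_sqr; exact: c2.
  apply: (@midpoint_poincare R (fun y => phi (x, y)) (fun y => phi2 (x, y))) => //.
  exact: phi0.
Qed.

End squares.

(** * Summation over the grid *)

Section grid.
Context {R : realType}.
Notation nu := (@plane_measure R).
Variable l : R.
Hypothesis l0 : 0 < l.
Implicit Types (U : set (R * R)) (k : nat * int) (b : R).

(** Columns start at the mouth [x = 1] of the horn. The axis separates the rows [0] and [-1], so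
    that midlines lie at odd multiples of [l / 2]. *)
Definition cell k : set (R * R) := square (1 + k.1%:R * l) (k.2%:~R * l) l.

(** Reading the index off the point gives at once disjointness of the cells and covering of the
    half-plane [1 <= p.1]. *)
Lemma cellP k (p : R * R) : cell k p <->
  [/\ 1 <= p.1, k.1 = Num.truncn ((p.1 - 1) / l) & k.2 = Num.floor (p.2 / l)].
Proof.
case: k p => [j i] [x y]; rewrite /cell /square/= !in_itv/=.
have il : i%:~R * l + l = (i + 1)%:~R * l by rewrite intrD mulrDl mul1r.
have jl : 1 + j%:R * l + l = 1 + j.+1%:R * l by rewrite -natr1 mulrDl mul1r addrA.
have -> : (1 + j%:R * l <= x < 1 + j%:R * l + l) =
    (j%:R <= (x - 1) / l < j.+1%:R).
  by rewrite jl ler_pdivlMr// ltr_pdivrMr// lerBrDl ltrBlDl.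
have -> : (i%:~R * l <= y < i%:~R * l + l) = (i%:~R <= y / l < (i + 1)%:~R).
  by rewrite il ler_pdivlMr// ltr_pdivrMr.
split=> [[jx iy]|[x1 -> ->]]; last first.
  by rewrite floor_itv truncn_itv// divr_ge0 ?subr_ge0// ltW.
split.
- have : 0 <= (x - 1) / l by case/andP: jx => + _; apply: le_trans.
  by rewrite pmulr_lge0 ?invr_gt0// subr_ge0.
- by symmetry; apply: truncn_def.
- by symmetry; apply: floor_def.
Qed.

Lemma measurable_cell k : measurable (cell k).
Proof. exact: measurable_square. Qed.

Lemma trivIset_cell (D : set (nat * int)) : trivIset D cell.
Proof.
move=> [j i] [j' i'] _ _ [p [/cellP[/= _ -> ->] /cellP[/= _ -> ->]]].
by [].
Qed.

Lemma cell_measure_lty k : (nu (cell k) < +oo)%E.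
Proof.
rewrite /nu product_measure1E//.
have h x := lebesgue_measure_itvco x l0.
by rewrite [X in (X * _)%E]h [X in (_ * X)%E]h -EFinM ltry.
Qed.

(** Cells may stick out of [U] and [U] may not be covered by the cells of [s]; both integrals equal
    the one over the union of the cells because [F] vanishes elsewhere. *)
Lemma Rintegral_cells U (s : seq (nat * int)) (F : R * R -> R) :
  uniq s -> bounded_mfun setT F -> (forall p, 0 <= F p) ->
  (forall p, F p != 0 -> U p /\ exists2 k, k \in s & cell k p) ->
  \int[nu]_(p in U) F p = \sum_(k <- s) \int[nu]_(p in cell k) F p.
Proof.
move=> us bF F0 Fs.
have Fi k : nu.-integrable (cell k) (EFin \o F).
  apply: bounded_mfun_integrable; [exact: measurable_cell|exact: cell_measure_lty|].
  exact: bounded_mfunS bF.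
pose D := \big[setU/set0]_(k <- s) cell k.
transitivity (\int[nu]_(p in D) F p).
  rewrite Rintegral_mkcond [RHS]Rintegral_mkcond; apply: eq_Rintegral => p _.
  rewrite !patchE.
  have [->|/Fs[Up [k ks kp]]] := eqVneq (F p) 0; first by do 2 case: ifP.
  rewrite !mem_set//; rewrite /D -bigcup_seq; exists k => //.
rewrite /Rintegral (ge0_integral_bigsetU nu)//.
- rewrite (eq_bigr (fun k => (\int[nu]_(p in cell k) F p)%:E)); last first.
    move=> k _; rewrite /Rintegral fineK//; apply: integrable_fin_num => //.
    exact: measurable_cell.
  by rewrite sumEFin.
- exact: measurable_cell.
- exact: trivIset_cell.
- by apply/measurable_EFinP; case: bF => mF _; exact: measurable_funTS.
- by move=> p _; rewrite lee_fin.
Qed.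

(** The last term keeps the integrals over the cells of [S] instead of assuming that they vanish:
    the lemma is applied to approximants of a function with zero means, whose own means are only
    small. *)
Lemma cells_poincare U phi phi1 phi2 b (S : seq (nat * int)) :
  C1_function U phi phi1 phi2 -> 0 < b -> b * l < pi -> uniq S ->
  (forall p, U p -> 1 <= p.1) ->
  (forall k, k \notin S -> forall x : R, 1 + k.1%:R * l <= x ->
     ~ U (x, (k.2%:~R + 1 / 2) * l)) ->
  b ^+ 2 * \int[nu]_(p in U) phi p ^+ 2 <=
  \int[nu]_(p in U) phi1 p ^+ 2 + \int[nu]_(p in U) phi2 p ^+ 2 +
  b ^+ 2 / l ^+ 2 * \sum_(k <- S) (\int[nu]_(p in cell k) phi p) ^+ 2.
Proof.
move=> C1 b0 bl uS U1 US.
have [M suppM] := C1_support C1.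
pose N := (Num.truncn (`|M| / l)).+1.
(* [N] columns and the rows from [-N] to [N - 1] cover the part of the support of [phi] with
   abscissa at least 1. *)
pose grid := [seq (j, i%:Z - N%:Z) | j <- iota 0 N, i <- iota 0 (N + N)].
(* All of [S] is kept, even cells off the support, since the conclusion sums over the whole of
   [S]. *)
pose s := S ++ [seq k <- undup grid | k \notin S].
have us : uniq s.
  rewrite cat_uniq uS filter_uniq ?undup_uniq// andbT.
  by apply/hasPn => k; rewrite mem_filter => /andP[].
have NM : `|M| / l < N%:R by rewrite truncnS_gt.
have sP p : U p -> `|p.1| < M -> `|p.2| < M -> exists2 k, k \in s & cell k p.
  move=> /U1 p1 p1M p2M.
  have M0 : 0 < M by rewrite (le_lt_trans _ p1M).
  rewrite ger0_norm ?ltW// in NM.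
  exists (Num.truncn ((p.1 - 1) / l), Num.floor (p.2 / l)); last exact/cellP.
  rewrite mem_cat mem_filter mem_undup; case: (_ \in S) => //=.
  have n0 : 0 <= (p.1 - 1) / l by rewrite divr_ge0 ?subr_ge0// ltW.
  have jN : (Num.truncn ((p.1 - 1) / l) < N)%N.
    rewrite -(ltr_nat R) (le_lt_trans _ NM)//
      (@le_trans _ _ ((p.1 - 1) / l)) ?truncn_le//.
    by rewrite ler_pM2r ?invr_gt0//; move: p1M; rewrite ltr_norml => /andP[_ ?]; lra.
  have /andP[fN Nf] : - (N%:Z) <= Num.floor (p.2 / l) < N%:Z.
    move: p2M; rewrite ltr_norml => /andP[Mp pM].
    apply/andP; split.
      rewrite floor_ge_int// mulrNz -pmulrn ltW// (lt_trans (_ : _ < - (M / l)))//.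
        by rewrite ltrN2.
      by rewrite -mulNr ltr_pM2r ?invr_gt0.
    rewrite floor_lt_int// -pmulrn (lt_trans _ NM)//.
    by rewrite ltr_pM2r ?invr_gt0.
  have : exists i : nat, (i < N + N)%N /\ Num.floor (p.2 / l) = i%:Z - N%:Z.
    exists `|(Num.floor (p.2 / l) + N%:Z)%R|%N.
    have f0 : 0 <= Num.floor (p.2 / l) + N%:Z by rewrite -lerBlDr sub0r.
    by rewrite -ltz_nat gez0_abs// PoszD ltrD2r addrK.
  move=> [i [iN ->]]; apply/allpairsP; exists (Num.truncn ((p.1 - 1) / l), i).
  by rewrite !mem_iota.
have supp (F : R * R -> R) : (forall p, ~ U p -> F p = 0) ->
    (forall p, ~ (`|p.1| < M /\ `|p.2| < M) -> F p = 0) ->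
    forall p, F p ^+ 2 != 0 -> U p /\ exists2 k, k \in s & cell k p.
  move=> FU FM p; rewrite expf_eq0/= => Fp.
  have Up : U p by apply: contrapT => /FU /eqP; rewrite (negbTE Fp).
  split => //.
  have [] : `|p.1| < M /\ `|p.2| < M.
    by apply: contrapT => /FM /eqP; rewrite (negbTE Fp).
  exact: sP.
have cells (F : R * R -> R) : bounded_mfun setT F ->
    (forall p, ~ U p -> F p = 0) ->
    (forall p, ~ (`|p.1| < M /\ `|p.2| < M) -> F p = 0) ->
    \int[nu]_(p in U) F p ^+ 2 = \sum_(k <- s) \int[nu]_(p in cell k) F p ^+ 2.
  move=> bF FU FM; apply: Rintegral_cells => //.
  - exact: (bounded_mfunX2 bF).
  - by move=> p; exact: sqr_ge0.
  - exact: supp.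
rewrite (cells _ (C1_bounded C1)); first last.
  by move=> p /suppM[].
  by move=> p /(C1_vanish C1)[].
rewrite (cells _ (C1_bounded1 C1)); first last.
  by move=> p /suppM[].
  by move=> p /(C1_vanish C1)[].
rewrite (cells _ (C1_bounded2 C1)); first last.
  by move=> p /suppM[].
  by move=> p /(C1_vanish C1)[].
rewrite /s !big_cat/=; set r := [seq k <- _ | _].
have hS : b ^+ 2 * \sum_(k <- S) \int[nu]_(p in cell k) phi p ^+ 2 <=
    \sum_(k <- S) \int[nu]_(p in cell k) phi1 p ^+ 2 +
    \sum_(k <- S) \int[nu]_(p in cell k) phi2 p ^+ 2 +
    b ^+ 2 / l ^+ 2 * \sum_(k <- S) (\int[nu]_(p in cell k) phi p) ^+ 2.
  rewrite !mulr_sumr -!big_split/=; apply: ler_sum => k _.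
  have := square_poincare (1 + k.1%:R * l) (k.2%:~R * l) C1 l0 b0 bl.
  by rewrite mulrBr lerBlDr; rewrite (mulrC (_ ^+ 2) (l ^- 2)) mulrA.
have hr : b ^+ 2 * \sum_(k <- r) \int[nu]_(p in cell k) phi p ^+ 2 <=
    \sum_(k <- r) \int[nu]_(p in cell k) phi2 p ^+ 2.
  rewrite mulr_sumr big_seq [leRHS]big_seq; apply: ler_sum => k.
  rewrite mem_filter => /andP[kS _]; apply: (square_midline C1 l0 b0 bl) => x jx.
  have := US k kS x jx; rewrite mulrDl (mulrAC 1) mul1r.
  by move=> /(C1_vanish C1)[].
(* On the cells outside [S] the vertical derivative suffices; the horizontal energy there is
   dropped. *)
have h1 : 0 <= \sum_(k <- r) \int[nu]_(p in cell k) phi1 p ^+ 2.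
  by apply: sumr_ge0 => k _; apply: Rintegral_ge0 => p _; exact: sqr_ge0.
rewrite mulrDr (le_trans (lerD hS hr))// -subr_ge0.
by rewrite (_ : _ - _ = \sum_(k <- r) \int[nu]_(p in cell k) phi1 p ^+ 2)//; ring.
Qed.

End grid.

(** * Test functions *)

Section test_functions.
Context {R : realType}.
Notation nu := (@plane_measure R).
Implicit Types (phi f : R * R -> R) (U K : set (R * R)).

Lemma continuous_vanish_bounded_mfun f K :
  compact K -> continuous f -> (forall p, ~ K p -> f p = 0) -> bounded_mfun setT f.
Proof.
move=> cK cf f0; split; first exact: plane_continuous_measurable.
have /compact_bounded[M [_ fM]] : compact (f @` K).
  by apply: continuous_compact => //; exact: continuous_subspaceT.
have M1 : M < `|M| + 1 by rewrite ltr_pwDr// ler_norm.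
exists (`|M| + 1) => p _; have [Kp|/f0 ->] := pselect (K p).
  by apply: (fM _ M1); exists p.
by rewrite normr0 addr_ge0.
Qed.

Lemma derive_vanish phi (v p : R * R) :
  ~ closure [set p | phi p != 0] p -> 'D_v phi p = 0.
Proof.
move=> ncl; rewrite (_ : 0 = 'D_v (fun=> 0 : R) p); last by rewrite derive_cst.
apply: near_eq_derive.
have oC : open (~` closure [set p | phi p != 0]).
  by apply: closed_openC; exact: closed_closure.
have := open_nbhs_nbhs (conj oC ncl).
apply: filterS => q nq; apply/eqP/negPn/negP => /= q0.
by apply: nq; exact: subset_closure.
Qed.

Lemma test_function_C1 U phi : test_function U phi ->
  C1_function U phi (partial1 phi) (partial2 phi).
Proof.
move=> [smooth_phi compact_supp suppU].
have d0 p : differentiable phi p by exact: (smooth_phi [::] p).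
have d1 v p : differentiable ('D_v phi) p by exact: (smooth_phi [:: v] p).
have c0 : continuous phi by move=> p; exact: differentiable_continuous.
have c1 v : continuous ('D_v phi) by move=> p; exact: differentiable_continuous.
set K := closure _ in compact_supp suppU.
have phiK p : ~ K p -> phi p = 0.
  move=> nK; apply/eqP/negPn/negP => p0; apply: nK; exact: subset_closure.
have DK v p : ~ K p -> 'D_v phi p = 0 by exact: derive_vanish.
(* The difference quotient of a slice is the directional one, so derivability and the value of the
   derivative transfer together. *)
have slice1 (x y : R) :
    (fun h : R => h^-1 *: (((fun x : R => phi (x, y)) \o shift x) (h *: (1 : R))
       - phi (x, y))) =
    (fun h : R => h^-1 *: ((phi \o shift (x, y)) (h *: ((1, 0) : R * R))
       - phi (x, y))).
  apply/funext => h /=; congr (_ *: (phi _ - _)).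
  by congr pair => /=; rewrite scaler0 add0r.
have slice2 (x y : R) :
    (fun h : R => h^-1 *: (((fun y : R => phi (x, y)) \o shift y) (h *: (1 : R))
       - phi (x, y))) =
    (fun h : R => h^-1 *: ((phi \o shift (x, y)) (h *: ((0, 1) : R * R))
       - phi (x, y))).
  apply/funext => h /=; congr (_ *: (phi _ - _)).
  by congr pair => /=; rewrite scaler0 add0r.
split.
- exact: continuous_vanish_bounded_mfun compact_supp c0 phiK.
- exact: continuous_vanish_bounded_mfun compact_supp (c1 _) (DK _).
- exact: continuous_vanish_bounded_mfun compact_supp (c1 _) (DK _).
- move=> x y; have := @diff_derivable _ _ _ phi (x, y) (1, 0) (d0 _).
  by move=> dphi; split; rewrite /derivable /derive slice1.
- move=> x y; have := @diff_derivable _ _ _ phi (x, y) (0, 1) (d0 _).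
  by move=> dphi; split; rewrite /derivable /derive slice2.
- move=> y x; apply: (@continuous_comp _ _ _ (fun x : R => (x, y)) (partial1 phi)).
    apply: (@cvg_pair R R R (nbhs x) (nbhs x) (nbhs y) _ _ _ (fun x => x) (fun=> y)).
      exact: cvg_id.
    exact: cvg_cst.
  exact: c1.
- move=> x y; apply: (@continuous_comp _ _ _ (fun y : R => (x, y)) (partial2 phi)).
    apply: (@cvg_pair R R R (nbhs y) (nbhs x) (nbhs y) _ _ _ (fun=> x) (fun y => y)).
      exact: cvg_cst.
    exact: cvg_id.
  exact: c1.
- move=> p nU; have nK : ~ K p by move=> /suppU.
  by split; [exact: phiK|exact: DK|exact: DK].
- have [M [_ KM]] := compact_bounded compact_supp.
  (* Compactness gives a weak bound by every radius above [M], such as [|M| + 1]; one more unit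
     makes it strict. *)
  exists (`|M| + 2) => p pM; have nK : ~ K p.
    have M1 : M < `|M| + 1 by rewrite ltr_pwDr// ler_norm.
    move=> /(KM _ M1) pM1; apply: pM; move: pM1; rewrite /= ProdNormedZmodule.prod_normE.
    rewrite ge_max => /andP[h1 h2]; split.
      by rewrite (le_lt_trans h1)// ltrD2l ltr1n.
    by rewrite (le_lt_trans h2)// ltrD2l ltr1n.
  by split; [exact: phiK|exact: DK|exact: DK].
Qed.

Lemma C1_function0 U : C1_function U (fun=> 0) (fun=> 0) (fun=> 0).
Proof.
split=> //; try exact: bounded_mfun_cst.
- by move=> x y; exact: is_derive_cst.
- by move=> x y; exact: is_derive_cst.
- by move=> y x; exact: cvg_cst.
- by move=> x y; exact: cvg_cst.
- by exists 0.
Qed.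

Lemma C1_functionZD U (c : R) f f1 f2 phi phi1 phi2 :
  C1_function U f f1 f2 -> C1_function U phi phi1 phi2 ->
  C1_function U (fun p => c * f p + phi p) (fun p => c * f1 p + phi1 p)
    (fun p => c * f2 p + phi2 p).
Proof.
move=> Cf Cphi.
have bZD (g h : R * R -> R) : bounded_mfun setT g -> bounded_mfun setT h ->
    bounded_mfun setT (fun p => c * g p + h p).
  move=> bg bh.
  have bcg : bounded_mfun setT (fun p => c * g p).
    by apply: (bounded_mfunM _ bg); exact: bounded_mfun_cst.
  have b0h : bounded_mfun setT (fun p => 0 - h p).
    by apply: (bounded_mfunB _ bh); exact: bounded_mfun_cst.
  rewrite (_ : (fun p => _) = (fun p => c * g p - (0 - h p))).
    exact: bounded_mfunB.
  by apply/funext => p; ring.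
split.
- exact: bZD (C1_bounded Cf) (C1_bounded Cphi).
- exact: bZD (C1_bounded1 Cf) (C1_bounded1 Cphi).
- exact: bZD (C1_bounded2 Cf) (C1_bounded2 Cphi).
- move=> x y; have df := C1_derive1 Cf x y; have dphi := C1_derive1 Cphi x y.
  exact: is_deriveD (is_deriveZ c df) dphi.
- move=> x y; have df := C1_derive2 Cf x y; have dphi := C1_derive2 Cphi x y.
  exact: is_deriveD (is_deriveZ c df) dphi.
- move=> y x; apply: cvgD; last exact: (C1_continuous1 Cphi).
  by apply: cvgM; [exact: cvg_cst|exact: (C1_continuous1 Cf)].
- move=> x y; apply: cvgD; last exact: (C1_continuous2 Cphi).
  by apply: cvgM; [exact: cvg_cst|exact: (C1_continuous2 Cf)].
- move=> p nU; have [-> -> ->] := C1_vanish Cf nU.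
  by have [-> -> ->] := C1_vanish Cphi nU; rewrite mulr0 addr0.
- have [M fM] := C1_support Cf; have [N phiN] := C1_support Cphi.
  exists (Num.max M N) => p pMN.
  have [-> -> ->] : [/\ f p = 0, f1 p = 0 & f2 p = 0].
    by apply: fM => -[p1 p2]; apply: pMN; rewrite !lt_max p1 p2.
  have [-> -> ->] : [/\ phi p = 0, phi1 p = 0 & phi2 p = 0].
    by apply: phiN => -[p1 p2]; apply: pMN; rewrite !lt_max p1 p2 !orbT.
  by rewrite mulr0 addr0.
Qed.

End test_functions.

(** * The space L^2 *)

Section L2_theory.
Context {R : realType}.
Notation nu := (@plane_measure R).
Variable U : set (R * R).
Hypothesis mU : measurable U.
Implicit Types u v w : R * R -> R.

Lemma L2_integrableM u v : L2 U u -> L2 U v ->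
  nu.-integrable U (EFin \o (fun p => u p * v p)).
Proof.
move=> [mu iu] [mv iv].
have iuv : nu.-integrable U (EFin \o (fun p => u p ^+ 2 + v p ^+ 2)).
  rewrite (_ : _ \o _ = (fun p => (u p ^+ 2)%:E + (v p ^+ 2)%:E)%E).
    exact: integrableD.
  by apply/funext => p; rewrite /= EFinD.
apply: le_integrable iuv => //.
  by apply/measurable_EFinP; exact: measurable_funM.
move=> p _; rewrite lee_fin normrM [leRHS]ger0_norm; last first.
  by rewrite addr_ge0// sqr_ge0.
rewrite -(real_normK (num_real (u p))) -(real_normK (num_real (v p))).
set a := `|u p|; set b := `|v p|.
have : 0 <= (a - b) ^+ 2 by exact: sqr_ge0.
have : 0 <= (a + b) ^+ 2 by exact: sqr_ge0.
by rewrite sqrrB sqrrD -mulr_natl => *; lra.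
Qed.

Lemma L2_ZD (c : R) u v : L2 U u -> L2 U v -> L2 U (fun p => c * u p + v p).
Proof.
move=> Lu Lv; have [mu iu] := Lu; have [mv iv] := Lv.
have mcuv : measurable_fun U (fun p => c * u p + v p).
  by apply: measurable_funD => //; apply: measurable_funM => //; exact: measurable_cst.
split=> //.
have iuv := L2_integrableM Lu Lv.
rewrite (_ : (fun p => _) = (fun p => (c ^+ 2)%:E * (u p ^+ 2)%:E +
    ((2 * c)%:E * (u p * v p)%:E + (v p ^+ 2)%:E))%E).
  apply: integrableD => //; first exact: integrableZl.
  by apply: integrableD => //; exact: integrableZl.
by apply/funext => p; rewrite -!EFinM -!EFinD; congr _%:E; ring.
Qed.

Lemma L2_0 : L2 U (fun=> 0).
Proof.
split; first exact: measurable_cst.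
rewrite (_ : (fun=> _) = cst 0%E); first exact: integrable0.
by apply/funext => p; rewrite expr0n.
Qed.

Lemma L2_innerC u v : L2_inner U u v = L2_inner U v u.
Proof. by apply: eq_Rintegral => p _; rewrite mulrC. Qed.

Lemma L2_inner_ge0 u : 0 <= L2_inner U u u.
Proof. by apply: Rintegral_ge0 => p _; rewrite -expr2 sqr_ge0. Qed.

Lemma L2_innerZDl (c : R) u v w : L2 U u -> L2 U v -> L2 U w ->
  L2_inner U (fun p => c * u p + v p) w = c * L2_inner U u w + L2_inner U v w.
Proof.
move=> Lu Lv Lw; rewrite /L2_inner -RintegralZl//; last exact: L2_integrableM.
rewrite -RintegralD//; last 2 first.
- rewrite (_ : _ \o _ = (fun p => c%:E * (u p * w p)%:E)%E).
    by apply: integrableZl => //; exact: L2_integrableM.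
  by apply/funext => p; rewrite /= EFinM.
- exact: L2_integrableM.
by apply: eq_Rintegral => p _; rewrite mulrDl mulrA.
Qed.

Lemma L2_inner_sqrZD (c : R) u v : L2 U u -> L2 U v ->
  L2_inner U (fun p => c * u p + v p) (fun p => c * u p + v p) =
  c ^+ 2 * L2_inner U u u + 2 * c * L2_inner U u v + L2_inner U v v.
Proof.
move=> Lu Lv; have Luv := L2_ZD c Lu Lv.
rewrite L2_innerZDl// !(L2_innerC _ (fun p => c * u p + v p)) !L2_innerZDl//.
by rewrite (L2_innerC v u); ring.
Qed.

(** A weighted form of the triangle inequality for squared norms, free of square roots. The cross
    term is bounded by expanding the squared norm of [v - eps * u] and dividing by [eps]. *)
Lemma L2_inner_sqr_le (eps : R) u v : 0 < eps -> L2 U u -> L2 U v ->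
  L2_inner U (fun p => u p + v p) (fun p => u p + v p) <=
  (1 + eps) * L2_inner U u u + (1 + eps^-1) * L2_inner U v v.
Proof.
move=> eps0 Lu Lv.
have -> : (fun p => u p + v p) = (fun p => 1 * u p + v p).
  by apply/funext => p; rewrite mul1r.
rewrite L2_inner_sqrZD//.
have := L2_inner_ge0 (fun p => - eps * u p + v p).
rewrite L2_inner_sqrZD// => h.
have : 0 <= eps^-1 * ((- eps) ^+ 2 * L2_inner U u u +
    2 * - eps * L2_inner U u v + L2_inner U v v).
  by rewrite mulr_ge0// invr_ge0 ltW.
rewrite (_ : eps^-1 * _ = eps * L2_inner U u u - 2 * L2_inner U u v +
    eps^-1 * L2_inner U v v); last by field; rewrite gt_eqF.
by move=> ?; rewrite expr1n !mulr1 !mulrDl !mul1r; lra.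
Qed.

Lemma L2_sum (T : Type) (s : seq T) (c : T -> R) (u : T -> R * R -> R) :
  (forall i, L2 U (u i)) -> L2 U (fun p => \sum_(i <- s) c i * u i p).
Proof.
move=> Lu; elim: s => [|i s IH].
  by under [X in L2 U X]eq_fun do rewrite big_nil; exact: L2_0.
by under [X in L2 U X]eq_fun do rewrite big_cons; exact: L2_ZD.
Qed.

Lemma L2_inner_suml (T : Type) (s : seq T) (c : T -> R) (u : T -> R * R -> R) w :
  (forall i, L2 U (u i)) -> L2 U w ->
  L2_inner U (fun p => \sum_(i <- s) c i * u i p) w =
  \sum_(i <- s) c i * L2_inner U (u i) w.
Proof.
move=> Lu Lw; elim: s => [|i s IH].
  under [X in L2_inner U X]eq_fun do rewrite big_nil.
  rewrite big_nil /L2_inner (_ : (fun p => _) = (fun=> 0)).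
    by rewrite Rintegral_cst// mul0r.
  by apply/funext => p; rewrite mul0r.
under [X in L2_inner U X]eq_fun do rewrite big_cons.
by rewrite L2_innerZDl ?IH ?big_cons//; exact: L2_sum.
Qed.

Lemma L2_inner_sum (T : Type) (s : seq T) (c c' : T -> R) (u v : T -> R * R -> R) :
  (forall i, L2 U (u i)) -> (forall i, L2 U (v i)) ->
  L2_inner U (fun p => \sum_(i <- s) c i * u i p)
             (fun p => \sum_(i <- s) c' i * v i p) =
  \sum_(i <- s) \sum_(j <- s) c i * c' j * L2_inner U (u i) (v j).
Proof.
move=> Lu Lv; rewrite L2_inner_suml//; last exact: L2_sum.
apply: eq_bigr => i _; rewrite L2_innerC L2_inner_suml// mulr_sumr.
by apply: eq_bigr => j _; rewrite L2_innerC mulrA.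
Qed.

Lemma L2_inner_eq0 u : L2 U u -> L2_inner U u u = 0 ->
  {ae nu, forall p, U p -> u p = 0}.
Proof.
move=> [mu iu] u0.
have mu2 : measurable_fun U (EFin \o (fun p => u p ^+ 2)).
  by apply/measurable_EFinP; exact: measurable_funX.
have : (\int[nu]_(p in U) `|(EFin \o (fun p => (u p ^+ 2)%R)) p| = 0)%E.
  transitivity (\int[nu]_(p in U) (u p ^+ 2)%:E)%E.
    by apply: eq_integral => p _; rewrite gee0_abs// lee_fin sqr_ge0.
  rewrite -[LHS]fineK; first by congr _%:E.
  exact: integrable_fin_num.
move/(ae_eq_integral_abs nu mU mu2); apply: filterS => p h /h /eqP.
by rewrite /= eqe sqrf_eq0 => /eqP.
Qed.

Lemma L2_inner0 u v : L2 U u -> L2 U v -> L2_inner U u u = 0 ->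
  L2_inner U u v = 0.
Proof.
move=> Lu Lv u0; apply: contrapT => /eqP uv.
(* Since [u] has norm zero, the squared norm of [c * u + v] is affine in [c]; this [c] would make it
   equal to [-1]. *)
have := L2_inner_ge0 (fun p => - (L2_inner U v v + 1) / (2 * L2_inner U u v) * u p + v p).
rewrite L2_inner_sqrZD// u0 mulr0 add0r.
rewrite (_ : 2 * _ * _ = - (L2_inner U v v + 1)); last by field.
by move=> ?; lra.
Qed.

End L2_theory.

(** * Approximation in H^1_0 *)

Section approximable.
Context {R : realType}.
Notation nu := (@plane_measure R).
Variable U : set (R * R).
Hypothesis mU : measurable U.
Implicit Types u v w phi : R * R -> R.

(** [eta] bounds the squared distance. Membership in [L2] is required as well because a real
    integral that diverges to infinity takes the value 0. *)
Definition L2_close (eta : R) phi u : Prop :=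
  L2 U (fun p => phi p - u p) /\
  L2_inner U (fun p => phi p - u p) (fun p => phi p - u p) <= eta.

(** What the counting keeps of [H10]: it is closed under linear combinations by the closure of
    [C1_function], without combining iterated directional derivatives of test functions. *)
Definition approximable u u1 u2 : Prop :=
  [/\ L2 U u, L2 U u1, L2 U u2 & forall eta : R, 0 < eta ->
    exists phi phi1 phi2, [/\ C1_function U phi phi1 phi2,
      L2_close eta phi u, L2_close eta phi1 u1 & L2_close eta phi2 u2]].

Lemma L2_cvg_close (phi_ : nat -> R * R -> R) u (eta : R) : 0 < eta ->
  (forall n, measurable_fun U (phi_ n)) -> L2 U u -> L2_cvg U phi_ u ->
  \forall n \near \oo, L2_close eta (phi_ n) u.
Proof.
move=> eta0 mphi [mu iu] /fine_cvgP[fin_near /cvgr0_norm_lt /(_ _ eta0) cvg_near].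
near=> n.
have fin_n : (\int[nu]_(p in U) ((phi_ n p - u p) ^+ 2)%:E)%E \is a fin_num.
  by near: n.
have me : measurable_fun U (fun p => phi_ n p - u p) by exact: measurable_funB.
have me2 : measurable_fun U (EFin \o (fun p => (phi_ n p - u p) ^+ 2)).
  by apply/measurable_EFinP; exact: measurable_funX.
split.
  split=> //; apply/integrableP; split=> //.
  have : (\int[nu]_(p in U) ((phi_ n p - u p) ^+ 2)%:E < +oo)%E.
    by rewrite ltey_eq fin_n.
  apply: le_lt_trans; rewrite le_eqVlt; apply/orP; left; apply/eqP.
  by apply: eq_integral => p _; rewrite gee0_abs// lee_fin sqr_ge0.
apply: le_trans (ler_norm _) _; apply: ltW.
rewrite /L2_inner; near: n; exact: cvg_near.
Unshelve. all: by end_near. Qed.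

Lemma H10_approximable u u1 u2 : H10 U u u1 u2 -> approximable u u1 u2.
Proof.
move=> [[Lu Lu1 Lu2 _] [phi_ [test_phi cvg_phi cvg_phi1 cvg_phi2]]].
split=> // eta eta0.
have C1_phi n := test_function_C1 (test_phi n).
have mphi n : measurable_fun U (phi_ n).
  by have [+ _] := C1_bounded (C1_phi n); exact: measurable_funTS.
have mphi1 n : measurable_fun U (partial1 (phi_ n)).
  by have [+ _] := C1_bounded1 (C1_phi n); exact: measurable_funTS.
have mphi2 n : measurable_fun U (partial2 (phi_ n)).
  by have [+ _] := C1_bounded2 (C1_phi n); exact: measurable_funTS.
have h0 := L2_cvg_close eta0 mphi Lu cvg_phi.
have h1 := L2_cvg_close eta0 mphi1 Lu1 cvg_phi1.
have h2 := L2_cvg_close eta0 mphi2 Lu2 cvg_phi2.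
have [n [? ? ?]] : exists n, [/\ L2_close eta (phi_ n) u,
    L2_close eta (partial1 (phi_ n)) u1 & L2_close eta (partial2 (phi_ n)) u2].
  near \oo => n; exists n; split; near: n; [exact: h0|exact: h1|exact: h2].
by exists (phi_ n), (partial1 (phi_ n)), (partial2 (phi_ n)); split.
Unshelve. all: by end_near. Qed.

Lemma L2_closeZD (c eta : R) phi psi u v :
  L2_close eta phi u -> L2_close eta psi v ->
  L2_close (2 * (c ^+ 2 + 1) * eta) (fun p => c * phi p + psi p)
    (fun p => c * u p + v p).
Proof.
move=> [Le e_le] [Lf f_le].
rewrite /L2_close (_ : (fun p => _ - _) =
    (fun p => c * (phi p - u p) + (psi p - v p))); last first.
  by apply/funext => p; ring.
split; first exact: L2_ZD.
rewrite L2_inner_sqrZD//.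
(* Parallelogram argument: the opposite combination bounds the cross term, whence the factor 2. *)
have := L2_inner_ge0 U (fun p => - c * (phi p - u p) + (psi p - v p)).
rewrite L2_inner_sqrZD// sqrrN => ge0.
have c2 : c ^+ 2 * L2_inner U (fun p => phi p - u p) (fun p => phi p - u p) <=
    c ^+ 2 * eta by rewrite ler_wpM2l// sqr_ge0.
lra.
Qed.

Lemma approximable0 : approximable (fun=> 0) (fun=> 0) (fun=> 0).
Proof.
have L0 := L2_0 U.
have close0 eta : 0 < eta -> L2_close eta (fun=> 0) (fun=> 0).
  move=> /ltW eta0; rewrite /L2_close (_ : (fun p => _ - _) = (fun=> 0)).
    by split => //; rewrite /L2_inner Rintegral_cst// mul0r mul0r.
  by apply/funext => p; rewrite subr0.
split=> // eta eta0; exists (fun=> 0), (fun=> 0), (fun=> 0).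
by split; [exact: C1_function0|exact: close0..].
Qed.

Lemma approximableZD (c : R) u u1 u2 v v1 v2 :
  approximable u u1 u2 -> approximable v v1 v2 ->
  approximable (fun p => c * u p + v p) (fun p => c * u1 p + v1 p)
    (fun p => c * u2 p + v2 p).
Proof.
move=> [Lu Lu1 Lu2 au] [Lv Lv1 Lv2 av]; split; [exact: L2_ZD..|].
move=> eta eta0; pose k := 2 * (c ^+ 2 + 1).
have k0 : 0 < k by rewrite mulr_gt0// ltr_wpDl// sqr_ge0.
have etak : 0 < eta / k by rewrite divr_gt0.
have [phi [phi1 [phi2 [Cphi c0 c1 c2]]]] := au _ etak.
have [psi [psi1 [psi2 [Cpsi d0 d1 d2]]]] := av _ etak.
exists (fun p => c * phi p + psi p), (fun p => c * phi1 p + psi1 p),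
  (fun p => c * phi2 p + psi2 p).
have -> : eta = k * (eta / k) by rewrite mulrCA divff ?mulr1// gt_eqF.
by split; [exact: C1_functionZD|exact: L2_closeZD..].
Qed.

Lemma approximable_sum (T : Type) (s : seq T) (c : T -> R)
    (u u1 u2 : T -> R * R -> R) :
  (forall i, approximable (u i) (u1 i) (u2 i)) ->
  approximable (fun p => \sum_(i <- s) c i * u i p)
    (fun p => \sum_(i <- s) c i * u1 i p) (fun p => \sum_(i <- s) c i * u2 i p).
Proof.
move=> au; elim: s => [|i s IH].
  have E (f : T -> R * R -> R) : (fun p => \sum_(i <- [::]) c i * f i p) = (fun=> 0).
    by apply/funext => p; rewrite big_nil.
  by rewrite !E; exact: approximable0.
have E (f : T -> R * R -> R) : (fun p => \sum_(i <- i :: s) c i * f i p) =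
    (fun p => c i * f i p + \sum_(i <- s) c i * f i p).
  by apply/funext => p; rewrite big_cons.
by rewrite !E; exact: approximableZD.
Qed.

Lemma L2_cauchy_schwarz (D : set (R * R)) (m : R) u : measurable D -> D `<=` U ->
  0 < m -> (nu D <= m%:E)%E -> L2 U u ->
  (\int[nu]_(p in D) u p) ^+ 2 / m <= L2_inner U u u.
Proof.
move=> mD DU m0 Dm [mu iu].
have Doo : (nu D < +oo)%E by rewrite (le_lt_trans Dm)// ltry.
have Dfin : nu D \is a fin_num by rewrite ge0_fin_numE.
have iD2 : nu.-integrable D (EFin \o (fun p => u p ^+ 2)) by exact: integrableS iu.
have LD : L2 D u by split=> //; exact: measurable_funS mu.
have L1 : L2 D (fun=> 1).
  split; first exact: measurable_cst.
  apply: (@bounded_mfun_integrable _ _ _ nu D (fun=> 1 ^+ 2)) => //.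
  exact: bounded_mfun_cst.
set T := \int[nu]_(p in D) u p.
have innerT : L2_inner D u (fun=> 1) = T by apply: eq_Rintegral => p _; rewrite mulr1.
have inner1 : L2_inner D (fun=> 1) (fun=> 1) <= m.
  rewrite /L2_inner Rintegral_cst// mulr1 mul1r -lee_fin fineK//.
(* Nonnegativity of the squared distance from [u] to the constant [T / m], which would be its mean
   if [D] had measure exactly [m]. *)
have := L2_inner_ge0 D (fun p => - (T / m) * 1 + u p).
rewrite (L2_inner_sqrZD mD)// (L2_innerC _ (fun=> 1) u) innerT => h.
have T2 : (- (T / m)) ^+ 2 * L2_inner D (fun=> 1) (fun=> 1) <= T ^+ 2 / m.
  rewrite sqrrN expr_div_n (le_trans (ler_wpM2l _ inner1)) ?divr_ge0 ?sqr_ge0//.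
  by rewrite le_eqVlt; apply/orP; left; apply/eqP; field; rewrite gt_eqF.
have uDU : L2_inner D u u <= L2_inner U u u.
  have L2i X : L2 X u -> measurable X -> nu.-integrable X (EFin \o (fun p => u p * u p)).
    by move=> LX mX; exact: L2_integrableM.
  rewrite -lee_fin /L2_inner /Rintegral !fineK; last 2 first.
  - by apply: integrable_fin_num => //; exact: (L2i U).
  - by apply: integrable_fin_num => //; exact: (L2i D).
  apply: ge0_subset_integral => //.
    by apply/measurable_EFinP; exact: measurable_funM.
  by move=> p _; rewrite lee_fin -expr2 sqr_ge0.
have E : 2 * - (T / m) * T = - 2 * (T ^+ 2 / m) by ring.
by rewrite E in h; lra.
Qed.

End approximable.

(** * The spectral gap under finitely many mean conditions *)

Section approximable_poincare.
Context {R : realType}.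
Notation nu := (@plane_measure R).

(** The approximants [phi] need not have zero means, but on each cell of [S] the integral of [phi]
    is that of [phi - u], which Cauchy-Schwarz makes small. As [S] is finite, the total error
    vanishes in the limit. *)
Lemma approximable_poincare (U : set (R * R)) (l b : R) (S : seq (nat * int))
    (u u1 u2 : R * R -> R) :
  measurable U -> 0 < l -> 0 < b -> b * l < pi -> uniq S ->
  (forall p, U p -> 1 <= p.1) ->
  (forall k, k \notin S -> forall x : R, 1 + k.1%:R * l <= x ->
     ~ U (x, (k.2%:~R + 1 / 2) * l)) ->
  approximable U u u1 u2 ->
  (forall k, k \in S -> \int[nu]_(p in U `&` cell l k) u p = 0) ->
  b ^+ 2 * L2_inner U u u <= L2_inner U u1 u1 + L2_inner U u2 u2.
Proof.
move=> mU l0 b0 bl uS U1 US [Lu Lu1 Lu2 au] u0.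
set G := _ + _; set x := b ^+ 2 * _.
have G0 : 0 <= G by rewrite addr_ge0// L2_inner_ge0.
have nu_cell k : (nu (U `&` cell l k) <= (l ^+ 2)%:E)%E.
  apply: (@le_trans _ _ (nu (cell l k))).
    apply: le_measure; rewrite ?inE//.
      by apply: measurableI => //; exact: measurable_cell.
    exact: measurable_cell.
  rewrite /nu product_measure1E//.
  have h y := lebesgue_measure_itvco y l0.
  by rewrite [X in (X * _)%E]h [X in (_ * X)%E]h -EFinM.
have mUcell k : measurable (U `&` cell l k).
  by apply: measurableI => //; exact: measurable_cell.
(* One factor [1 + eps] comes from replacing [u] by [phi], the other from replacing the gradient of
   [phi] by that of [u]. For [eps <= 1] the excess over [G] is at most [eps * (3 * G + 1)]. *)
suff approx eps : 0 < eps -> x <= (1 + eps) ^+ 2 * G + eps.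
  apply/ler_addgt0Pr => e e0; pose eps := Num.min 1 (e / (3 * G + 1)).
  have G3 : 0 < 3 * G + 1 by rewrite ltr_wpDl// mulr_ge0.
  have eps0 : 0 < eps by rewrite lt_min ltr01 divr_gt0.
  have eps1 : eps <= 1 by rewrite ge_min lexx.
  have : eps * (3 * G + 1) <= e by rewrite -ler_pdivlMr// ge_min lexx orbT.
  have : eps ^+ 2 * G <= eps * G by rewrite ler_wpM2r// expr2 ler_piMl// ltW.
  by move=> h1 h2; apply: le_trans (approx _ eps0) _; rewrite sqrrD expr1n; lra.
move=> eps0; have ieps0 : 0 < eps^-1 by rewrite invr_gt0.
(* [K] is the total coefficient of [eta] in the final estimate, so that [eta := eps / K] makes the
   error exactly [eps]. *)
pose K := (1 + eps^-1) * b ^+ 2 + (1 + eps) * (2 * (1 + eps^-1) + b ^+ 2 * (size S)%:R).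
have b2 : 0 < b ^+ 2 by rewrite exprn_gt0.
have eps1 : 0 < 1 + eps by rewrite addr_gt0.
have ieps1 : 0 < 1 + eps^-1 by rewrite addr_gt0.
have K0 : 0 < K.
  rewrite ltr_pwDl ?mulr_gt0// mulr_ge0 ?(ltW eps1)// addr_ge0//.
    by rewrite mulr_ge0// ltW.
  by rewrite mulr_ge0// ltW.
pose eta := eps / K; have eta0 : 0 < eta by rewrite divr_gt0.
have [phi [phi1 [phi2 [C1 [Le ee] [Le1 ee1] [Le2 ee2]]]]] := au _ eta0.
have expand (f v : R * R -> R) : L2 U v -> L2 U (fun p => f p - v p) ->
    L2_inner U (fun p => f p - v p) (fun p => f p - v p) <= eta ->
    L2_inner U f f <= (1 + eps) * L2_inner U v v + (1 + eps^-1) * eta.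
  move=> Lv Lfv fv; have := L2_inner_sqr_le mU eps0 Lv Lfv.
  rewrite (_ : (fun p => v p + _) = f); last by apply/funext => p; ring.
  by move/le_trans; apply; rewrite lerD2l ler_pM2l.
have Lphi : L2 U phi.
  rewrite (_ : phi = (fun p => 1 * (phi p - u p) + u p)); first exact: L2_ZD.
  by apply/funext => p; ring.
have uphi : L2_inner U u u <= (1 + eps) * L2_inner U phi phi + (1 + eps^-1) * eta.
  have Leu : L2 U (fun p => u p - phi p).
    rewrite (_ : (fun p => _) = (fun p => -1 * (phi p - u p) + 0)).
      by apply: L2_ZD => //; exact: L2_0.
    by apply/funext => p; ring.
  apply: expand => //; apply: le_trans ee; rewrite le_eqVlt; apply/orP; left.
  by apply/eqP; apply: eq_Rintegral => p _; ring.
have phi1u := expand phi1 u1 Lu1 Le1 ee1.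
have phi2u := expand phi2 u2 Lu2 Le2 ee2.
have := cells_poincare l0 C1 b0 bl uS U1 US.
have sqE (f : R * R -> R) : \int[nu]_(p in U) f p ^+ 2 = L2_inner U f f by [].
rewrite !sqE.
have sum_le : b ^+ 2 / l ^+ 2 * \sum_(k <- S) (\int[nu]_(p in cell l k) phi p) ^+ 2 <=
    b ^+ 2 * (size S)%:R * eta.
  rewrite -(mulrA (b ^+ 2) (l ^- 2)) -(mulrA (b ^+ 2) (size S)%:R) ler_pM2l//.
  rewrite mulr_natl mulr_sumr.
  rewrite (_ : eta *+ size S = \sum_(k <- S) eta); last first.
    by rewrite big_const_seq count_predT iter_addr_0.
  rewrite big_seq [leRHS]big_seq; apply: ler_sum => k kS.
  rewrite mulrC.
  (* [phi] vanishes off [U] and [u] has zero integral over the part of the cell in [U]. *)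
  have -> : \int[nu]_(p in cell l k) phi p = \int[nu]_(p in U `&` cell l k) (phi p - u p).
    have iI (f : R * R -> R) : L2 U f -> nu.-integrable (U `&` cell l k) (EFin \o f).
      move=> [mf if2].
      have Lf : L2 (U `&` cell l k) f.
        split; first by apply: measurable_funS mf.
        refine (integrableS _ _ _ if2); [exact: mU|exact: mUcell|exact: subIsetl].
      have L1 : L2 (U `&` cell l k) (fun=> 1).
        split; first exact: measurable_cst.
        apply: (@bounded_mfun_integrable _ _ _ nu _ (fun=> 1 ^+ 2)).
        - exact: mUcell.
        - exact: (le_lt_trans (nu_cell k) (ltry _)).
        - exact: bounded_mfun_cst.
      have := L2_integrableM (mUcell k) Lf L1.
      rewrite (_ : (fun p => f p * 1) = f)//.
      by apply/funext => p; rewrite mulr1.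
    rewrite RintegralB; [|exact: mUcell|exact: iI..].
    rewrite (u0 _ kS) subr0 Rintegral_mkcond [RHS]Rintegral_mkcond.
    apply: eq_Rintegral => p _; rewrite !patchE (in_setI p U).
    have [Up|nU] := pselect (U p); first by rewrite (mem_set Up).
    by have [-> _ _] := C1_vanish C1 nU; do 2 case: ifP.
  apply: le_trans ee; apply: (L2_cauchy_schwarz mU (mUcell k)) (nu_cell k) Le.
    exact: subIsetl.
  by rewrite exprn_gt0.
move=> main.
have bphi : b ^+ 2 * L2_inner U phi phi <=
    (1 + eps) * G + (2 * (1 + eps^-1) + b ^+ 2 * (size S)%:R) * eta.
  apply: le_trans main _; apply: le_trans (lerD (lerD phi1u phi2u) sum_le) _.
  by rewrite /G le_eqVlt; apply/orP; left; apply/eqP; ring.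
have : x <= (1 + eps) * (b ^+ 2 * L2_inner U phi phi) + (1 + eps^-1) * b ^+ 2 * eta.
  rewrite /x (le_trans (ler_wpM2l (ltW b2) uphi))//.
  by rewrite le_eqVlt; apply/orP; left; apply/eqP; ring.
move/le_trans; apply.
apply: le_trans (lerD (ler_wpM2l (ltW eps1) bphi) (lexx _)) _.
have Keta : K * eta = eps by rewrite /eta mulrCA divff ?mulr1// gt_eqF.
rewrite -[X in _ <= _ + X]Keta.
by rewrite /K le_eqVlt; apply/orP; left; apply/eqP; ring.
Qed.

End approximable_poincare.

(** * Counting eigenvalues *)

Section counting.
Context {R : realType}.
Notation nu := (@plane_measure R).
Variables (U : set (R * R)) (l b lambda : R) (S : seq (nat * int)).
Hypotheses (mU : measurable U) (l0 : 0 < l) (b0 : 0 < b) (bl : b * l < pi).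
Hypotheses (lambdab : lambda < b ^+ 2) (uS : uniq S).
Hypothesis U1 : forall p, U p -> 1 <= p.1.
Hypothesis US : forall k, k \notin S -> forall x : R, 1 + k.1%:R * l <= x ->
  ~ U (x, (k.2%:~R + 1 / 2) * l).

Lemma exists_left_kernel (m n : nat) (A : 'M[R]_(m, n)) : (n < m)%N ->
  exists2 v : 'rV[R]_m, v != 0 & v *m A = 0.
Proof.
move=> nm; have /rowV0Pn[v vA v0] : kermx A != 0.
  rewrite -mxrank_eq0 mxrank_ker -lt0n subn_gt0.
  exact: leq_ltn_trans (rank_leq_col A) nm.
by exists v => //; exact/sub_kermxP.
Qed.

(** Independence is assumed only among functions of one eigenvalue [k], which is what multiplicities
    provide; across eigenvalues the symmetry of the form gives orthogonality. More functions than
    cells would leave a nontrivial combination with zero mean on every cell, whose energy would be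
    both at least [b ^ 2] and at most [lambda] times its squared norm. *)
Lemma orthogonal_eigenfunctions_card (T : finType) (mu : T -> R)
    (u u1 u2 : T -> R * R -> R) :
  (forall i, approximable U (u i) (u1 i) (u2 i)) ->
  (forall i j, L2_inner U (u1 i) (u1 j) + L2_inner U (u2 i) (u2 j) =
     mu i * L2_inner U (u i) (u j)) ->
  (forall i, mu i <= lambda) ->
  (forall (k : R) (c : T -> R), (forall i, mu i != k -> c i = 0) ->
     {ae nu, forall p, U p -> \sum_(i : T) c i * u i p = 0} ->
     forall i, c i = 0) ->
  (#|T| <= size S)%N.
Proof.
move=> au eigen mu_le indep; rewrite leqNgt; apply/negP => ST.
have Lu i : L2 U (u i) by have [] := au i.
have Lu1 i : L2 U (u1 i) by have [] := au i.
have Lu2 i : L2 U (u2 i) by have [] := au i.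
have orth i j : mu i != mu j -> L2_inner U (u i) (u j) = 0.
  move=> ij; have := eigen i j.
  rewrite (L2_innerC U (u1 i)) (L2_innerC U (u2 i)) eigen (L2_innerC U (u j)).
  move/eqP; rewrite -subr_eq0 -mulrBl mulf_eq0 subr_eq0 eq_sym (negbTE ij)/=.
  by move/eqP.
pose A := \matrix_(i < #|T|, k < size S)
  \int[nu]_(p in U `&` cell l (nth (0%N, 0) S k)) u (enum_val i) p.
have [v v0 vA] := exists_left_kernel A ST.
pose c i := v 0 (enum_rank i).
pose w p := \sum_(i : T) c i * u i p.
have Lw : L2 U w by exact: (L2_sum mU).
have w0 k : k \in S -> \int[nu]_(p in U `&` cell l k) w p = 0.
  move=> kS; pose D := U `&` cell l k.
  have mD : measurable D by apply: measurableI => //; exact: measurable_cell.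
  have LuD i : L2 D (u i).
    have [mui ui2] := Lu i; split.
      by apply: (measurable_funS mU _ mui); exact: subIsetl.
    by refine (integrableS _ _ _ ui2); [exact: mU|exact: mD|exact: subIsetl].
  have LD1 : L2 D (fun=> 1).
    split; first exact: measurable_cst.
    apply: (@bounded_mfun_integrable _ _ _ nu _ (fun=> 1 ^+ 2)).
    - exact: mD.
    - apply: (@le_lt_trans _ _ (nu (cell l k))); last exact: cell_measure_lty.
      apply: le_measure; rewrite ?inE; [exact: mD|exact: measurable_cell|].
      exact: subIsetr.
    - exact: bounded_mfun_cst.
  have int1 (f : R * R -> R) : \int[nu]_(p in D) f p = L2_inner D f (fun=> 1).
    by apply: eq_Rintegral => p _; rewrite mulr1.
  rewrite int1 (L2_inner_suml mD)//.
  have kk : (index k S < size S)%N by rewrite index_mem.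
  have := congr1 (fun M : 'M[R]_(1, size S) => M 0 (Ordinal kk)) vA; rewrite !mxE => vA0.
  rewrite -[RHS]vA0 (reindex_onto enum_rank enum_val)/=; last first.
    by move=> i _; rewrite enum_valK.
  apply: eq_big => [i|i _]; first by rewrite enum_rankK eqxx.
  by rewrite mxE enum_rankK nth_index// -/D int1.
have Q := approximable_poincare mU l0 b0 bl uS U1 US
  (approximable_sum mU (index_enum T) c au) w0.
have Qle : L2_inner U (fun p => \sum_(i : T) c i * u1 i p)
      (fun p => \sum_(i : T) c i * u1 i p) +
    L2_inner U (fun p => \sum_(i : T) c i * u2 i p)
      (fun p => \sum_(i : T) c i * u2 i p) <= lambda * L2_inner U w w.
  rewrite /w !(L2_inner_sum mU)// -subr_ge0.
  (* Eigenfunctions of one eigenvalue need not be orthogonal, so the form is not diagonal. Only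
     pairs with [mu i = mu j] survive, and for them [lambda - mu i] splits into two equal square
     roots; the defect is thus a squared norm. *)
  pose d i := Num.sqrt (lambda - mu i) * c i.
  set X := lambda * _ - _; suff -> : X = L2_inner U (fun p => \sum_(i : T) d i * u i p)
      (fun p => \sum_(i : T) d i * u i p) by exact: L2_inner_ge0.
  rewrite /X (L2_inner_sum mU)// mulr_sumr -big_split -sumrB/=; apply: eq_bigr => i _.
  rewrite mulr_sumr -big_split -sumrB/=; apply: eq_bigr => j _.
  rewrite -mulrDr eigen /d.
  have [ij|/orth ->] := eqVneq (mu i) (mu j); last by rewrite !mulr0 subrr.
  rewrite -ij (_ : lambda * _ - _ =
    (lambda - mu i) * (c i * c j * L2_inner U (u i) (u j))); last by ring.
  rewrite -[in LHS](@sqr_sqrtr _ (lambda - mu i)) ?subr_ge0//; ring.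
have ww0 : L2_inner U w w = 0.
  apply/eqP; rewrite eq_le L2_inner_ge0 andbT.
  have : b ^+ 2 * L2_inner U w w <= lambda * L2_inner U w w by exact: le_trans Q Qle.
  by rewrite -subr_le0 -mulrBl pmulr_rle0// subr_gt0.
have [i0 ci0] : exists i, c i != 0.
  apply: contrapT => /forallNP c0; move/eqP: v0; apply.
  apply/rowP => i; rewrite mxE.
  have /negP/negPn/eqP := c0 (enum_val i).
  by rewrite /c enum_valK.
(* The component of [w] in the eigenspace of [mu i0] also has norm zero, and it is to this component
   that the independence hypothesis applies. *)
pose c' i := if mu i == mu i0 then c i else 0.
have w'0 : L2_inner U (fun p => \sum_(i : T) c' i * u i p)
    (fun p => \sum_(i : T) c' i * u i p) = 0.
  rewrite (L2_inner_sum mU)// big1// => i _.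
  transitivity (c' i * L2_inner U w (u i)); last first.
    by rewrite (L2_inner0 mU)// mulr0.
  rewrite (L2_inner_suml mU)// mulr_sumr; apply: eq_bigr => j _.
  rewrite -mulrA (L2_innerC U (u j)) /c'.
  case: ifP => [/eqP ii0|]; last by rewrite !mul0r.
  have [ij|ij] := eqVneq (mu i) (mu j); first by rewrite -ij ii0 eqxx.
  by rewrite orth// !mulr0.
have c'0 i : mu i != mu i0 -> c' i = 0 by move=> /negbTE; rewrite /c' => ->.
have := indep _ _ c'0 (L2_inner_eq0 mU (L2_sum mU _ _ Lu) w'0) i0.
by rewrite /c' eqxx => c00; move: ci0; rewrite c00 eqxx.
Qed.


Lemma dirichlet_eigenspace_card (T : finType) (mu : T -> R)
    (u : T -> R * R -> R) :
  (forall i, dirichlet_eigenspace U (mu i) (u i)) ->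
  (forall i, mu i <= lambda) ->
  (forall (k : R) (c : T -> R), (forall i, mu i != k -> c i = 0) ->
     {ae nu, forall p, U p -> \sum_(i : T) c i * u i p = 0} ->
     forall i, c i = 0) ->
  (#|T| <= size S)%N.
Proof.
move=> eig mu_le indep.
have /choice[du dudef] : forall i, exists v : (R * R -> R) * (R * R -> R),
    H10 U (u i) v.1 v.2 /\ forall w w1 w2, H10 U w w1 w2 ->
      L2_inner U v.1 w1 + L2_inner U v.2 w2 = mu i * L2_inner U (u i) w.
  by move=> i; have [u1 [u2 ?]] := eig i; exists (u1, u2).
apply: (@orthogonal_eigenfunctions_card T mu u (fun i => (du i).1)
  (fun i => (du i).2)) => //.
- by move=> i; apply: H10_approximable; exact: (dudef i).1.
- by move=> i j; exact: (dudef i).2 _ _ _ (dudef j).1.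
Qed.

(** [size S] bounds the size of every independent family, so the supremum that defines the
    multiplicity is attained. *)
Lemma dirichlet_multiplicity_finite (mu : R) : mu <= lambda ->
  exists (n : nat) (u : 'I_n -> R * R -> R),
    [/\ forall i, dirichlet_eigenspace U mu (u i), L2_independent U u &
      (dirichlet_multiplicity U mu <= n%:R%:E)%E].
Proof.
move=> mu_le.
pose P n := `[< exists u : 'I_n -> R * R -> R,
  (forall i, dirichlet_eigenspace U mu (u i)) /\ L2_independent U u >].
have P0 : exists n, P n.
  exists 0%N; apply/asboolP; exists (fun _ _ => 0).
  by split => [[]//|c _ []].
have PS n : P n -> (n <= size S)%N.
  move=> /asboolP[u [eig indep]]; rewrite -[n]card_ord.
  apply: (@dirichlet_eigenspace_card _ (fun=> mu) u) => // k c _ ae0.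
  exact: indep ae0.
case: (ex_maxnP P0 PS) => n /asboolP[u [eig indep]] nmax.
exists n, u; split => //; apply: ge_ereal_sup => _ [m mP <-].
by rewrite lee_fin ler_nat; apply: nmax; exact/asboolP.
Qed.

Lemma almost_everywhere_plane_filter : Filter (almost_everywhere nu).
Proof. exact: ae_filter_ringOfSetsType. Qed.

(** Maximal families of the distinct eigenvalues are joined into one family, indexed by a sigma
    type, so that [size S] bounds the sum of the multiplicities and not just each of them. *)
Lemma dirichlet_multiplicity_sum_le (s : seq R) : uniq s ->
  (forall mu, mu \in s -> mu <= lambda) ->
  (\sum_(mu <- s) dirichlet_multiplicity U mu <= (size S)%:R%:E)%E.
Proof.
move=> us s_le.
have /choice[e edef] : forall mu : R, exists nu_ : {n : nat & 'I_n -> R * R -> R},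
    mu <= lambda ->
    [/\ forall i, dirichlet_eigenspace U mu (tagged nu_ i),
      L2_independent U (tagged nu_) &
      (dirichlet_multiplicity U mu <= (tag nu_)%:R%:E)%E].
  move=> mu; have [/dirichlet_multiplicity_finite[n [u ?]]|] := pselect (mu <= lambda).
    by exists (existT _ n u).
  (* Above [lambda] the choice defaults to the empty family. *)
  by exists (existT _ 0%N (fun _ _ => 0)).
pose m := size s; pose k (i : 'I_m) := tag (e (nth 0 s i)).
pose T := {i : 'I_m & 'I_(k i)}.
pose mu (t : T) := nth 0 s (tag t).
pose u (t : T) : R * R -> R := tagged (e (nth 0 s (tag t))) (tagged t).
have mus (t : T) : mu t <= lambda by apply/s_le/mem_nth.
have eig (t : T) : dirichlet_eigenspace U (mu t) (u t).
  by have [+ _ _] := edef _ (mus t); exact.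
have indep (x : R) (c : T -> R) : (forall t, mu t != x -> c t = 0) ->
     {ae nu, forall p, U p -> \sum_(t : T) c t * u t p = 0} ->
     forall t, c t = 0.
  move=> c0 ae0 t; have [tx|/c0//] := eqVneq (mu t) x.
  have [_ ind _] := edef _ (mus t).
  case: t tx ind => i j /= ix ind.
  pose ci (j' : 'I_(k i)) := c (Tagged (fun i => 'I_(k i)) j').
  apply: (ind ci); move: ae0.
  apply: (@filterS _ _ almost_everywhere_plane_filter) => p h Up.
  rewrite -[RHS](h Up).
  transitivity (\sum_(i' : 'I_m) \sum_(j' : 'I_(k i'))
      c (Tagged (fun i => 'I_(k i)) j') * u (Tagged (fun i => 'I_(k i)) j') p).
    (* The entries of [s] are distinct, so the other blocks belong to other eigenvalues and have
       zero coefficients. *)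
    rewrite (bigD1 i)//= [X in _ + X]big1 ?addr0// => i' ii'.
    rewrite big1// => j' _; rewrite c0 ?mul0r//.
    by rewrite -ix /mu/= nth_uniq.
  rewrite sig_big_dep/=; apply: eq_bigr => -[i' j'] _ //=.
have := dirichlet_eigenspace_card eig mus indep.
rewrite card_tagged -(ler_nat R) -lee_fin; apply: le_trans.
rewrite sumnE big_map big_enum/=.
rewrite (big_nth 0) big_mkord natr_sum -sumEFin; apply: lee_sum => i _.
rewrite card_ord; have [_ _ ->] := edef _ (s_le _ (mem_nth 0 (ltn_ord i))).
by [].
Qed.

Lemma counting_function_le (Omega : set (R * R)) : Omega° = U ->
  (counting_function lambda Omega <= (size S)%:R%:E)%E.
Proof.
move=> OU; rewrite /counting_function OU; apply: ge_ereal_sup => _ [X [finX XA] <-].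
rewrite fsbig_finite//=; apply: dirichlet_multiplicity_sum_le.
  exact: fset_uniq.
by move=> mu; rewrite in_fset_set// inE => /XA.
Qed.

End counting.

(** * Regularly varying functions *)

Section regular_class_theory.
Context {R : realType}.
Variables (d : R) (h : R -> R).
Hypothesis d1 : 1 < d.
Hypothesis hd : regular_class d h.

Let h_gt0 x : 0 < x -> 0 < h x. Proof. exact: (regular_gt0 hd). Qed.

Lemma regular_lt x y : 0 < x -> x < y -> h x < h y.
Proof.
move=> x0 xy; apply: (regular_increasing hd) => //.
  by rewrite in_itv/= x0.
by rewrite in_itv/= (lt_trans x0).
Qed.

Lemma regular_le x y : 0 < x -> x <= y -> h x <= h y.
Proof.
move=> x0; rewrite le_eqVlt => /predU1P[->//|xy].
exact/ltW/regular_lt.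
Qed.

Lemma near_right0 (P : R -> Prop) : (\forall x \near 0^'+, P x) ->
  exists2 e : R, 0 < e & forall x, 0 < x < e -> P x.
Proof.
rewrite near_withinE => /nbhs_ballP[e /= e0 eP]; exists e => // x /andP[x0 xe].
by apply: eP => //; rewrite /ball/= sub0r normrN gtr0_norm.
Qed.

Lemma regular_surj y : 0 < y -> exists2 x, 0 < x & h x = y.
Proof.
move=> y0.
have [e e0 small] : exists2 e : R, 0 < e & forall x, 0 < x < e -> h x < y.
  apply: near_right0.
  have := cvgr_lt _ (regular_cvg0 hd) y; exact.
have [x2 [x2e hx2]] : exists x2, e <= x2 /\ y <= h x2.
  have big := (cvgryPge _).1 (regular_cvgy hd) y.
  near +oo_R => x2; exists x2; split; near: x2; last exact: big.
  by apply: nbhs_pinfty_ge; exact: num_real.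
have e2 : 0 < e / 2 by rewrite divr_gt0.
have e2x2 : e / 2 <= x2 by lra.
have ch : {within `[e / 2, x2], continuous h}.
  apply: continuous_subspaceW (regular_continuous hd) => z /=.
  by rewrite !in_itv/= => /andP[z1 _]; rewrite andbT (lt_le_trans _ z1).
have h1 : h (e / 2) < y by apply: small; rewrite e2/=; lra.
have [c] : exists2 c, c \in `[e / 2, x2] & h c = y.
  apply: IVT => //; rewrite ge_min le_max (ltW h1) hx2 orbT//.
rewrite in_itv/= => /andP[ce _] hc; exists c => //.
exact: lt_le_trans ce.
Unshelve. all: by end_near. Qed.

Lemma half_line_inverseP y : 0 < y ->
  0 < half_line_inverse h y /\ h (half_line_inverse h y) = y.
Proof.
move=> y0.
have surj : set_surj `]0, +oo[ `]0, +oo[ h.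
  move=> z /=; rewrite in_itv/= andbT => /regular_surj[x x0 hx].
  by exists x => //=; rewrite in_itv/= x0.
have yI : y \in (`]0, +oo[%classic : set R) by rewrite inE/= in_itv/= y0.
split; last exact: (surjpK _ surj).
have := @surjpinv_image_sub _ _ (fun=> 0) _ _ _ surj (half_line_inverse h y).
rewrite /= in_itv/= andbT; apply; exists y => //=.
by rewrite in_itv/= y0.
Qed.

(** Applying the increasing [h] to [c <= |p.2| <= g p.1] gives [h c <= 1 / p.1 <= 1 / a]. Membership
    in the horn is used below only through this condition, in which the inverse of [h] does not
    occur. *)
Lemma horn_point (a c : R) (p : R * R) : 0 < a -> 0 < c ->
  horn (fun x : R => half_line_inverse h (1 / x)) p -> a <= p.1 -> c <= `|p.2| ->
  a * h c <= 1.
Proof.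
move=> a0 c0 [p1 p2] ap cp.
have p0 : 0 < p.1 by rewrite (lt_le_trans a0).
have ip0 : 0 < 1 / p.1 by rewrite divr_gt0.
have [g0 hg] := half_line_inverseP ip0.
have : h c <= 1 / p.1 by rewrite -hg regular_le// (le_trans cp).
rewrite ler_pdivlMr// => hc; apply: le_trans hc; rewrite mulrC ler_wpM2l//.
exact/ltW/h_gt0.
Qed.

(** Equality holds at [d = 1]. Beyond it, [2 ^ (d - 1) > 1 + (d - 1) * ln 2] and [ln 2 >= 1 / 2]
    suffice. The strict gap is what lets the limit of [h (2 * x) / h x] yield an inequality near
    0. *)
Lemma powR2_gt : 1 + d < 2 `^ d.
Proof.
have ln2 : 1 / 2 <= ln (2 : R).
  have /(@le_ln1Dx R) : -1 < - (1 / 2) :> R by lra.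
  rewrite (_ : 1 + - (1 / 2) = 2^-1); last by field.
  by rewrite lnV ?posrE//; lra.
rewrite (_ : d = 1 + (d - 1)); last by ring.
rewrite powRD; last by rewrite pnatr_eq0 implybT.
rewrite powRr1//; have : 1 + (d - 1) / 2 < 2 `^ (d - 1).
  rewrite /powR pnatr_eq0/=; apply: le_lt_trans (expR_gt1Dx _).
    by rewrite lerD2l; apply: ler_wpM2l; [rewrite subr_ge0 ltW|rewrite -div1r].
  by rewrite mulf_neq0 ?subr_eq0 ?gt_eqF// (lt_le_trans _ ln2).
by move=> ?; lra.
Qed.

Lemma regular_ratio (t : R) : 0 < t -> h (t * x) / h x @[x --> 0^'+] --> t `^ d.
Proof.
move=> t0; have := @regular_variation _ _ _ hd [set t] (@compact_set1 _ t).
rewrite uniform_set1; apply.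
by move=> _ ->; rewrite /= in_itv/= t0.
Qed.

(** A doubling constant [q > 2] bounds the sum over odd multiples below by
    [(q - 1) / (q - 2) / h delta]; [q = 1 + d] is the value that produces [d / (d - 1)]. *)
Lemma regular_doubling :
  exists2 e : R, 0 < e & forall x, 0 < x < e -> (1 + d) * h x <= h (2 * x).
Proof.
apply: near_right0.
have := cvgr_gt _ (regular_ratio (ltr0n R 2)) _ powR2_gt => ratio.
near=> x; have x0 : 0 < x by near: x; exact: nbhs_right_gt.
rewrite -ler_pdivlMr ?h_gt0//; apply/ltW; near: x; exact: ratio.
Unshelve. all: by end_near. Qed.

(** * Sums of [1 / h] along arithmetic progressions *)

Section sums.
Variables (x0 delta : R).
Hypothesis doubling : forall x, 0 < x <= x0 -> (1 + d) * h x <= h (2 * x).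
Hypothesis delta0 : 0 < delta.

Let hk0 (k : nat) : 0 < h (k.+1%:R * delta).
Proof. by apply: h_gt0; rewrite mulr_gt0. Qed.

Lemma regular_inv_le (a b : R) : 0 < a -> a <= b -> (h b)^-1 <= (h a)^-1.
Proof.
move=> a0 ab; have b0 := lt_le_trans a0 ab.
by rewrite lef_pV2 ?posrE ?h_gt0// regular_le.
Qed.

(** Terms [2i] and [2i + 1] are both at most the even one, which doubling compares with term [i].
    The sum is thus at most [1 / h delta] plus [2 / (1 + d)] times the sum of half the length, and
    [(d + 1) / (d - 1)] is the fixed point of [s = 1 + 2 * s / (1 + d)]. *)
Lemma sum_inv_le (n : nat) : n%:R * delta <= 2 * x0 ->
  \sum_(k < n) (h (k.+1%:R * delta))^-1 <= (d + 1) / (d - 1) / h delta.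
Proof.
have hd0 := h_gt0 delta0.
have d0 : 0 < d - 1 by rewrite subr_gt0.
elim/ltn_ind: n => -[_ _|n IH nx].
  by rewrite big_ord0 !divr_ge0// ltW// addr_gt0// (lt_trans ltr01).
(* [n.+1] is [2m] or [2m + 1]; in the even case one positive term is added so that everything after
   the first term pairs up. *)
pose m := (n.+1)./2.
have mn : (m < n.+1)%N by rewrite /m -divn2 ltn_Pdiv.
have n2m : (n.+1 <= m.*2.+1)%N.
  by rewrite -[n.+1]odd_double_half -/m; case: odd; rewrite ?add1n ?add0n.
have mx : m%:R * delta <= x0.
  rewrite -(ler_pM2l (ltr0n R 2)) (le_trans _ nx)// mulrA ler_pM2r//.
  by rewrite -natrM ler_nat mul2n /m -[leqRHS]odd_double_half leq_addl.
have IHm := IH m mn _.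
have x00 : 0 <= x0 by rewrite (le_trans _ mx)// mulr_ge0// ltW.
have {}IHm : \sum_(k < m) (h (k.+1%:R * delta))^-1 <= (d + 1) / (d - 1) / h delta.
  by apply: IHm; lra.
have step k : (\sum_(i < k.*2.+1) (h (i.+1%:R * delta))^-1 <=
    (h delta)^-1 + \sum_(i < k) 2 * (h (2 * (i.+1%:R * delta)))^-1).
  elim: k => [|k IHk]; first by rewrite big_ord1 big_ord0 addr0 mul1r.
  rewrite doubleS big_ord_recr [in leLHS]big_ord_recr [in leRHS]big_ord_recr/=.
  rewrite -addrA [leRHS]addrA; apply: lerD; first exact: IHk.
  have E : (k.*2.+2)%:R = 2 * k.+1%:R :> R by rewrite -doubleS -muln2 natrM mulrC.
  rewrite mulrA -E [leRHS]mulr_natl mulr2n; apply: lerD => //.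
  by apply: regular_inv_le; rewrite ?mulr_gt0// ler_pM2r// ler_nat.
apply: (@le_trans _ _ (\sum_(i < m.*2.+1) (h (i.+1%:R * delta))^-1)).
  rewrite -(subnKC n2m) big_split_ord/= lerDl sumr_ge0// => i _.
  by rewrite ltW// invr_gt0.
apply: le_trans (step m) _.
apply: (@le_trans _ _ ((h delta)^-1 + 2 / (1 + d) * ((d + 1) / (d - 1) / h delta))).
  rewrite lerD2l.
  apply: (@le_trans _ _ (2 / (1 + d) * \sum_(k < m) (h (k.+1%:R * delta))^-1)).
    rewrite mulr_sumr; apply: ler_sum => i _; rewrite -mulrA ler_pM2l//.
    have id1 : 0 < 1 + d by rewrite addr_gt0// (lt_trans ltr01).
    have hi := hk0 i.
    rewrite -invfM lef_pV2 ?posrE ?h_gt0 ?mulr_gt0//.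
    apply: doubling; rewrite mulr_gt0//= (le_trans _ mx)// ler_pM2r// ler_nat.
    exact: ltn_ord.
  by rewrite ler_wpM2l// divr_ge0// ltW// addr_gt0// (lt_trans ltr01).
rewrite le_eqVlt; apply/orP; left; apply/eqP; field.
by rewrite !gt_eqF//= addr_gt0// (lt_trans ltr01).
Qed.

(** Each odd term after the first is at most the even term before it, so twice the odd sum is at
    most the full sum plus one more [1 / h delta]. The constant is half of
    [1 + (d + 1) / (d - 1)]. *)
Lemma sum_odd_le (m : nat) : 2 * (m%:R * delta) <= 2 * x0 ->
  \sum_(n < m) (h ((2 * n%:R + 1) * delta))^-1 <= d / (d - 1) / h delta.
Proof.
move=> mx; have d0 : 0 < d - 1 by rewrite subr_gt0.
have hd0 := h_gt0 delta0.
case: m mx => [_|m mx].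
  by rewrite big_ord0 !divr_ge0// ltW// (lt_trans ltr01).
have pair k : 2 * \sum_(n < k.+1) (h ((2 * n%:R + 1) * delta))^-1 <=
    (h delta)^-1 + \sum_(i < k.*2.+1) (h (i.+1%:R * delta))^-1.
  elim: k => [|k IHk].
    by rewrite !big_ord1 mulr0 add0r mul1r mulr_natl mulr2n.
  rewrite big_ord_recr mulrDr doubleS [in leRHS]big_ord_recr [in leRHS]big_ord_recr/=.
  rewrite -[in leRHS]addrA [leRHS]addrA; apply: lerD => //.
  have E : 2 * k.+1%:R + 1 = k.*2.+3%:R :> R.
    by rewrite -doubleS -[in RHS]natr1 -muln2 natrM mulrC.
  rewrite E [leLHS]mulr_natl mulr2n; apply: lerD => //.
  by apply: regular_inv_le; rewrite ?mulr_gt0// ler_pM2r// ler_nat.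
have mx' : (m.*2.+1)%:R * delta <= 2 * x0.
  by rewrite (le_trans _ mx)// mulrA ler_pM2r// -natrM ler_nat mul2n doubleS.
rewrite -(ler_pM2l (ltr0n R 2)) (le_trans (pair m))//.
apply: le_trans (lerD (lexx _) (sum_inv_le mx')) _.
rewrite le_eqVlt; apply/orP; left; apply/eqP; field.
by rewrite !gt_eqF.
Qed.

(** Doubling is available only up to [x0]. Every later term has its argument above [x0 / 2], and
    there are at most [K] of them. *)
Lemma sum_odd_total_le (K : nat) : 0 < x0 ->
  \sum_(n < K) (h ((2 * n%:R + 1) * delta))^-1 <=
  d / (d - 1) / h delta + K%:R / h (x0 / 2).
Proof.
move=> x00; pose m := Num.truncn (x0 / delta).
have q0 : 0 <= x0 / delta by rewrite divr_ge0// ltW.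
have mx : m%:R * delta <= x0 by rewrite -ler_pdivlMr// truncn_le.
have xm : x0 < m.+1%:R * delta by rewrite -ltr_pdivrMr// truncnS_gt.
have o0 (n : nat) : 0 < (2 * n%:R + 1) * delta by rewrite mulr_gt0// ltr_wpDl.
(* Lengthening the sum to [m + K] terms avoids comparing [m] with [K]. *)
apply: (@le_trans _ _ (\sum_(n < m + K) (h ((2 * n%:R + 1) * delta))^-1)).
  rewrite addnC big_split_ord/= lerDl sumr_ge0// => i _.
  by rewrite ltW// invr_gt0 h_gt0.
rewrite big_split_ord/=; apply: lerD.
  by apply: sum_odd_le; lra.
rewrite mulr_natl -[K in leRHS]card_ord -sumr_const; apply: ler_sum => i _.
apply: regular_inv_le; first by rewrite divr_gt0.
rewrite ler_pdivrMr// (le_trans (ltW xm))// mulrAC ler_pM2r//.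
rewrite natrD -natr1.
have : 0 <= m%:R :> R by []. have : 0 <= i%:R :> R by [].
by lra.
Qed.

End sums.

End regular_class_theory.

(** * The horn *)

Section horn_cells.
Context {R : realType}.
Variables (d : R) (h : R -> R) (l : R) (K : nat).
Hypothesis hd : regular_class d h.
Hypotheses (l0 : 0 < l) (l1 : l <= 1).

Let hn (n : nat) : R := h ((2 * n%:R + 1) * (l / 2)).

Let hn0 n : 0 < hn n.
Proof. by apply: (regular_gt0 hd); rewrite mulr_gt0 ?divr_gt0// ltr_wpDl. Qed.

(* The number of j with (1 + j l) h_n <= 1. *)
Let J (n : nat) : nat :=
  if hn n <= 1 then (Num.truncn (((hn n)^-1 - 1) / l)).+1 else 0%N.

(** Row [Negz n], that is [-(n + 1)], mirrors row [n] in the axis: both midlines are at distance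
    [(2n + 1) * l / 2] from it, where [h] takes the value [hn n]. *)
Definition horn_cells : seq (nat * int) := undup (
  [seq (j, Posz n) | n <- iota 0 K, j <- iota 0 (J n)] ++
  [seq (j, Negz n) | n <- iota 0 K, j <- iota 0 (J n)]).

(** The unit that rounding adds to each row is absorbed because the horn starts at [x = 1]: as
    [l <= 1], [((hn n)^-1 - 1) / l + 1 <= (hn n)^-1 / l]. The factor 2 counts both sides of the
    axis. *)
Lemma size_horn_cells : (size horn_cells)%:R <= 2 / l * \sum_(n < K) (hn n)^-1.
Proof.
apply: (@le_trans _ _ (2 * \sum_(n < K) (J n)%:R)).
  rewrite -natr_sum -natrM ler_nat (leq_trans (size_undup _))//.
  rewrite size_cat !size_allpairs_dep addnn -mul2n leq_mul2l/=.
  rewrite sumnE big_map -(big_mkord xpredT J) /index_iota subn0.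
  by under eq_bigr do rewrite size_iota.
rewrite -mulrA ler_pM2l// mulr_sumr; apply: ler_sum => n _.
rewrite /J; case: ifPn => [hn1|_]; last first.
  by rewrite mulr_ge0// invr_ge0 ltW.
have q0 : 0 <= ((hn n)^-1 - 1) / l.
  by rewrite divr_ge0 ?(ltW l0)// subr_ge0 invf_ge1.
rewrite -natr1 (@le_trans _ _ (((hn n)^-1 - 1) / l + 1))//.
  by rewrite lerD2r truncn_le.
by rewrite mulrBl mul1r -addrA mulrC gerDl addrC subr_le0 invf_ge1.
Qed.

(** By [horn_point], a midline point of the horn to the right of the left edge of cell [(j, i)]
    forces [(1 + j * l) * hn n <= 1], which puts the cell in the list. *)
Lemma notin_horn_cells k (x : R) : (forall n, hn n <= 1 -> (n < K)%N) ->
  k \notin horn_cells -> 1 + k.1%:R * l <= x ->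
  ~ horn (fun x : R => half_line_inverse h (1 / x)) (x, (k.2%:~R + 1 / 2) * l).
Proof.
case: k => j i /= hK + jx hornx.
have a0 : 0 < 1 + j%:R * l by rewrite ltr_pwDl// mulr_ge0// ltW.
have [n ni yi] : exists2 n : nat, i = Posz n \/ i = Negz n &
    `|(i%:~R + 1 / 2) * l| = (2 * n%:R + 1) * (l / 2).
  have pos n : 0 <= (n%:R + 1 / 2) * l :> R by rewrite mulr_ge0 ?(ltW l0)// addr_ge0.
  case: i {hornx} => n; exists n; [by left| |by right|].
    by rewrite -pmulrn ger0_norm//; field.
  rewrite NegzE mulrNz -pmulrn (_ : (_ + _) * l = - ((n%:R + 1 / 2) * l)).
    by rewrite normrN ger0_norm//; field.
  by rewrite -natr1; field.
have y0 : 0 < (2 * n%:R + 1) * (l / 2) by rewrite mulr_gt0 ?divr_gt0// ltr_wpDl.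
have jh : (1 + j%:R * l) * hn n <= 1.
  by apply: (horn_point hd a0 y0 hornx) => //=; rewrite yi.
have hn1 : hn n <= 1.
  apply: le_trans jh; rewrite ler_peMl ?(ltW (hn0 n))//.
  by rewrite lerDl mulr_ge0// ltW.
move=> /negP; apply; rewrite mem_undup mem_cat.
have nK := hK _ hn1.
have jJ : (j < J n)%N.
  rewrite /J hn1 ltnS truncn_ge_nat; last first.
    by rewrite divr_ge0 ?(ltW l0)// subr_ge0 invf_ge1.
  by rewrite ler_pdivlMr// lerBrDl -[(hn n)^-1]mul1r ler_pdivlMr.
by case: ni => ->; apply/orP; [left|right]; apply/allpairsPdep;
  exists n, j; rewrite !mem_iota.
Qed.

End horn_cells.

Theorem theorem6p1 (R : realType) (d : R) (h : R -> R) :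
  1 < d -> regular_class d h ->
  let g := fun x : R => half_line_inverse h (1 / x) in
  let f := fun x : R => 1 / h (1 / x) in
  let Omega := horn g in
  let F := fun lambda : R => Num.sqrt lambda * f (2 * Num.sqrt lambda / pi) in
  exists r : R -> R,
    (forall eps : R, 0 < eps ->
       \forall lambda \near +oo, `|r lambda| <= eps * `|F lambda|) /\
    \forall lambda \near +oo,
      (counting_function lambda Omega
        <= (d / (d - 1) * F lambda + r lambda)%:E)%E.
Proof.
move=> d1 hd g f Omega F; exists (fun=> 0); split.
  move=> eps eps0; near=> lambda.
  by rewrite normr0 mulr_ge0 ?(ltW eps0).
have pi0 := @pi_gt0 R.
(* All the room in the proof lies between 1 and [pi / 2]; equality is excluded since [cos 1 > 0]. *)
have pi2 : 1 < pi / 2 :> R.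
  rewrite lt_neqAle pihalf_ge1 andbT; apply/negP => /eqP pi1.
  by have := @cos1_gt0 R; rewrite pi1 cos_pihalf ltxx.
(* [q1] will be the limit of [t * h (t * x) / h x] and [q2] a bound for it near 0; the gap from [q2]
   to [pi / 2] pays for the terms beyond [x0]. *)
pose q1 : R := (1 + pi / 2) / 2; pose q2 : R := (q1 + pi / 2) / 2.
have q11 : 1 < q1 by rewrite /q1; lra.
have q12 : q1 < q2 by rewrite /q2 /q1; lra.
have q2pi : q2 < pi / 2 by rewrite /q2 /q1; lra.
have q10 : 0 < q1 by exact: lt_trans q11.
have q20 : 0 < q2 by exact: lt_trans q12.
have d0 : 0 < d by exact: lt_trans d1.
have dp : 0 < d + 1 by rewrite addr_gt0.
pose t : R := q1 `^ (1 / (d + 1)).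
have t1 : 1 < t.
  have p1 : 1 `^ (1 / (d + 1)) = 1 :> R by rewrite powR1.
  rewrite -[ltLHS]p1 gt0_ltr_powR ?nnegrE ?divr_gt0//.
  exact: ltW.
have t0 : 0 < t by exact: lt_trans t1.
have td : t * t `^ d = q1.
  rewrite -[X in X * _]powRr1 ?(ltW t0)// -powRD; last first.
    by rewrite (gt_eqF t0) implybT.
  by rewrite -powRrM (addrC 1) mulrC mul1r mulfV ?gt_eqF// powRr1// ltW.
(* [X] is the half-width of the horn at its mouth: midlines higher than [X] miss the horn. *)
have [X X0 hX] := regular_surj hd (@ltr01 R).
have [e1 e10 doubling] := regular_doubling d1 hd.
pose x0 := e1 / 2; have x00 : 0 < x0 by rewrite divr_gt0.
(* There are at most [X / delta] rows, so the tail [K / h (x0 / 2)] of the sum is at most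
   [kappa / delta]. *)
pose kappa := X / h (x0 / 2).
have hx0 : 0 < h (x0 / 2) by apply: (regular_gt0 hd); rewrite divr_gt0.
have kappa0 : 0 < kappa by rewrite divr_gt0.
pose A := d / (d - 1); have A0 : 0 < A by rewrite divr_gt0// subr_gt0.
(* The surplus left for the tail: [A + sigma = A * (pi / 2) / q2]. *)
pose sigma := A * (pi / 2 / q2 - 1).
have sigma0 : 0 < sigma by rewrite mulr_gt0// subr_gt0 ltr_pdivlMr// mul1r.
have [e e0 small] : exists2 e : R, 0 < e & forall x, 0 < x < e ->
    t * (h (t * x) / h x) < q2 /\ h x / x < sigma / kappa.
  apply: near_right0; near=> x; split; near: x.
    have : t * (h (t * x) / h x) @[x --> 0^'+] --> q1.
      by rewrite -td; apply: cvgM; [exact: cvg_cst|exact: regular_ratio].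
    by move/cvgr_lt; apply.
  by apply: (cvgr_lt _ (regular_div_cvg0 hd)); rewrite divr_gt0.
near=> lambda.
have lam0 : 0 < lambda by near: lambda; apply: nbhs_pinfty_gt; exact: num_real.
(* An upper bound for [delta]: [e] for the two limits, [X / 2] for [K <= X / delta], [1 / 2] for
   [l <= 1]. *)
pose m := Num.min e (Num.min (X / 2) (1 / 2)).
have m0 : 0 < m by rewrite !lt_min e0 !divr_gt0.
have sq0 : 0 < Num.sqrt lambda by rewrite sqrtr_gt0.
have sq_gt : pi / (2 * t * m) < Num.sqrt lambda.
  have p0 : 0 <= pi / (2 * t * m) by rewrite divr_ge0 ?(ltW pi0)// ltW// !mulr_gt0.
  rewrite -(ger0_norm p0) -sqrtr_sqr ltr_sqrt//.
  by near: lambda; apply: nbhs_pinfty_gt; exact: num_real.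
pose delta := pi / (2 * t * Num.sqrt lambda); pose l := 2 * delta.
have delta0 : 0 < delta by rewrite divr_gt0// !mulr_gt0.
have deltam : delta < m.
  move: sq_gt; rewrite /delta ltr_pdivrMr ?mulr_gt0// ltr_pdivrMr ?mulr_gt0//.
  by rewrite (_ : m * _ = Num.sqrt lambda * (2 * t * m))//; ring.
move: (deltam); rewrite !lt_min => /and3P[delta_e deltaX delta1].
have l0 : 0 < l by rewrite mulr_gt0.
have l1 : l <= 1 by rewrite /l; lra.
have lE : l / 2 = delta by rewrite /l mulrAC divff ?mul1r.
have [ratio hdiv] : t * (h (t * delta) / h delta) < q2 /\ h delta / delta < sigma / kappa.
  by apply: small; rewrite delta0.
have hdelta0 : 0 < h delta by exact: (regular_gt0 hd).
have htdelta0 : 0 < h (t * delta) by apply: (regular_gt0 hd); rewrite mulr_gt0.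
pose K := (Num.truncn (X / l)).+1.
pose S := horn_cells h l K.
have KP (n : nat) : h ((2 * n%:R + 1) * (l / 2)) <= 1 -> (n < K)%N.
  rewrite -[leRHS]hX lE => hn; rewrite ltnS truncn_ge_nat; last first.
    by rewrite divr_ge0// ltW.
  have nX : (2 * n%:R + 1) * delta <= X.
    rewrite leNgt; apply/negP => /(regular_lt hd X0); rewrite ltNge => /negP; exact.
  rewrite ler_pdivlMr// (le_trans _ nX)// /l mulrA ler_pM2r// mulrC lerDl//.
have KX : K%:R <= X / delta.
  have XlX : X / l + 1 <= X / delta.
    have -> : X / delta = 2 * (X / l) by rewrite /l; field; rewrite gt_eqF.
    have : 1 <= X / l by rewrite ler_pdivlMr// /l; lra.
    by lra.
  by apply: le_trans XlX; rewrite /K -natr1 lerD2r truncn_le divr_ge0// ltW.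
(* Halfway between [sqrt lambda] and [pi / l = t * sqrt lambda]. *)
pose b := Num.sqrt lambda * ((1 + t) / 2).
have b0 : 0 < b by rewrite mulr_gt0// divr_gt0// addr_gt0.
have bl : b * l < pi.
  rewrite (_ : b * l = pi * ((1 + t) / (2 * t))); last first.
    by rewrite /b /l /delta; field; rewrite !gt_eqF.
  by rewrite -[ltRHS]mulr1 ltr_pM2l// ltr_pdivrMr ?mulr_gt0//; lra.
have lambdab : lambda < b ^+ 2.
  rewrite /b exprMn sqr_sqrtr ?(ltW lam0)// -[ltLHS]mulr1 ltr_pM2l//.
  by rewrite exprn_egt1//; lra.
have mU : measurable Omega° by apply: plane_open_measurable; exact: open_interior.
have U1 (p : R * R) : Omega° p -> 1 <= p.1 by move=> /interior_subset[].
have US k : k \notin S -> forall x : R, 1 + k.1%:R * l <= x ->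
    ~ Omega° (x, (k.2%:~R + 1 / 2) * l).
  by move=> kS x kx /interior_subset; exact: (notin_horn_cells hd l0 KP kS kx).
have count_le : (counting_function lambda Omega <= (size S)%:R%:E)%E.
  exact: (counting_function_le mU l0 b0 bl lambdab (undup_uniq _) U1 US erefl).
apply: le_trans count_le _; rewrite lee_fin addr0.
apply: le_trans (size_horn_cells K hd l0 l1) _.
rewrite lE.
have doubling' x : 0 < x <= x0 -> (1 + d) * h x <= h (2 * x).
  by move=> /andP[xp xx0]; apply: doubling; rewrite xp/= (le_lt_trans xx0)// /x0; lra.
have sum_le := sum_odd_total_le d1 hd doubling' delta0 K x00.
apply: le_trans (ler_wpM2l _ sum_le) _; first by rewrite divr_ge0// ltW.
have FE : F lambda = pi / (2 * t * delta) / h (t * delta).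
  rewrite /F /f (_ : 1 / (2 * Num.sqrt lambda / pi) = t * delta); last first.
    by rewrite /delta; move: (pi : R) pi0 => p p0; field; rewrite !gt_eqF.
  rewrite (_ : Num.sqrt lambda = pi / (2 * t * delta)); first by rewrite mul1r.
  by rewrite /delta; move: (pi : R) pi0 => p p0; field; rewrite !gt_eqF.
rewrite FE -/A.
rewrite (_ : 2 / l = delta^-1); last by rewrite /l; field; rewrite gt_eqF.
rewrite [leRHS](_ : _ = delta^-1 * (A * (pi / 2) / (t * h (t * delta)))); last first.
  by move: (pi : R) => p; field; rewrite !gt_eqF.
rewrite ler_pM2l ?invr_gt0//.
(* Regular variation enters here, moving [h] from the argument [t * delta = pi / (2 * sqrt lambda)]
   of the claim to the half-side [delta] of the squares. *)
apply: (@le_trans _ _ (A * (pi / 2) / (q2 * h delta))); last first.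
  apply: ler_wpM2l; first exact: mulr_ge0 (ltW A0) (ltW (lt_trans ltr01 pi2)).
  have P1 : 0 < q2 * h delta := mulr_gt0 q20 hdelta0.
  have P2 : 0 < t * h (t * delta) := mulr_gt0 t0 htdelta0.
  rewrite lef_pV2 ?posrE//.
  by apply: ltW; rewrite -ltr_pdivrMr// -mulrA.
apply: (@le_trans _ _ (A / h delta + kappa / delta)).
  rewrite lerD2l ler_pdivrMr// /kappa.
  by rewrite [leRHS](_ : _ = X / delta)//; field; rewrite !gt_eqF.
have : kappa * (h delta / delta) <= sigma.
  by rewrite mulrC -ler_pdivlMr// ltW.
move=> kh; rewrite [leLHS](_ : _ = (A + kappa * (h delta / delta)) / h delta); last first.
  by field; rewrite !gt_eqF.
rewrite [leRHS](_ : _ = (A + sigma) / h delta); last first.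
  by rewrite /sigma; move: (pi : R) => p; field; rewrite !gt_eqF.
by rewrite ler_pM2r ?invr_gt0// lerD2l.
Unshelve. all: by end_near. Qed.
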